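(* There is an absolute constant $z_0$ such that the following holds for all $z\ge z_0$. Let $q$ be a positive integer all of whose prime factors are $\le z$, and let $f_q$, $G_q(1)$, $E(u)$, $H_j$, $H$, $J$ be as in the context. (1) For $1\le\xi\le\frac23\log z$ and all $u\ge0$, $$|E(u)|\le\exp\big(H(\xi)-\xi u+5J(\xi)\big).$$ (2) Let $\pi\le\xi\le\frac23\log z$ and suppose that $H(\xi)\ge20H_2(\xi)+76J(\xi)+20$, so that $$\tau:=\sqrt{\frac{5H_2(\xi)+19J(\xi)+5}{H(\xi)}}\ \le\ \frac12.$$ Then there exist points $u_+$ and $u_-$ in the interval $[H(\xi)(1-2\tau),\,H(\xi)(1+2\tau)]$ such that $$E(u_+)\ \ge\ \frac{1}{20\,\xi H(\xi)}\exp\{H(\xi)-\xi u_+-5H_2(\xi)-5J(\xi)\}$$ and $$E(u_-)\ \le\ -\frac{1}{20\,\xi H(\xi)}\exp\{H(\xi)-\xi u_--5H_2(\xi)-5J(\xi)\}.$$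
   Context: $f_q$ is a multiplicative function with $f_q(p^k)=1$ for all primes $p\nmid q$, $0\le f_q(n)\le1$ for all $n$, and $f_q(n)=f_q((n,q))$ (so $f_q$ is periodic mod $q$). Put $$G_q(1)=\prod_{p\mid q}\Big(1-\frac1p\Big)\Big(1+\frac{f_q(p)}{p}+\frac{f_q(p^2)}{p^2}+\cdots\Big),\qquad E(u)=\frac{1}{z^u}\sum_{n\le z^u}\big(f_q(n)-G_q(1)\big),$$ $$H_j(\xi)=\sum_{p\mid q}\frac{1-f_q(p)}{p}\,p^{\xi/\log z}\Big(\frac{\log(z/p)}{\log z}\Big)^j\ (j\ge0),\qquad H(\xi)=H_0(\xi),\qquad J(\xi)=\sum_{p\mid q}\frac1{p^2}\,p^{2\xi/\log z}.$$ Sums and products over $p\mid q$ run over primes. *)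

(* Defs.v *)
From mathcomp Require Import all_boot all_order all_algebra.
From mathcomp Require Import all_classical all_reals all_analysis.
Set Implicit Arguments.
Unset Strict Implicit.
Unset Printing Implicit Defensive.
Import Order.TTheory GRing.Theory Num.Theory.
Import numFieldNormedType.Exports.
Local Open Scope classical_set_scope.
Local Open Scope ring_scope.

(* Arithmetic functions are maps [f : nat -> R]; the value [f 0] is junk: it is
   never constrained and never used. *)

Definition multiplicative_function (R : realType) (f : nat -> R) : Prop :=
  f 1%N = 1 /\
  forall m n : nat, (0 < m)%N -> (0 < n)%N -> coprime m n ->
    f (m * n)%N = f m * f n.

Definition admissible (R : realType) (q : nat) (f : nat -> R) : Prop :=
  [/\ multiplicative_function f,
      forall p k : nat, prime p -> ~~ (p %| q)%N -> f (p ^ k)%N = 1,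
      forall n : nat, (0 < n)%N -> 0 <= f n <= 1 &
      forall n : nat, (0 < n)%N -> f n = f (gcdn n q)].

Section MeanValue.
Variables (R : realType) (q : nat) (f : nat -> R).

(* [primes q] lists each prime divisor of [q > 0] exactly once. *)
Definition G1 : R :=
  \prod_(p <- primes q)
    ((1 - p%:R^-1) *
     (1 + limn (series (fun k : nat => f (p ^ k.+1)%N / p%:R ^+ k.+1)))).

(* For [x >= 0], the integers [1 <= n < (Num.truncn x).+1] are those with
   [n <= x]. *)
Definition E (z u : R) : R :=
  (z `^ u)^-1 * \sum_(1 <= n < (Num.truncn (z `^ u)).+1) (f n - G1).

(* The convention 0 ^+ 0 = 1 makes [Hj 0] include the term [p = z] in full. *)
Definition Hj (j : nat) (z xi : R) : R :=
  \sum_(p <- primes q)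
    (1 - f p) / p%:R * p%:R `^ (xi / ln z) * (ln (z / p%:R) / ln z) ^+ j.

Definition H (z xi : R) : R := Hj 0 z xi.

Definition J (z xi : R) : R :=
  \sum_(p <- primes q) (p%:R ^+ 2)^-1 * p%:R `^ (2 * xi / ln z).

Definition tau (z xi : R) : R :=
  Num.sqrt ((5 * Hj 2 z xi + 19 * J z xi + 5) / H z xi).

End MeanValue.

(* Main.v *)
From HB Require Import structures.
Require Import Defs.
From mathcomp Require Import all_boot all_order all_algebra.
From mathcomp Require Import all_classical all_reals all_analysis.
From mathcomp Require Import measurable_realfun complex ring lra.

(** Let [g] be the Moebius transform of [f], so that [f n] is the sum of [g d] over
    [d %| n]. As [f n] depends only on [gcdn n q], the support of [g] lies in the
    divisors of [q]: every sum over [d] below is finite. In particular [G1] is the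
    sum of [g d / d], and with [x = z ^ u] and [{y}] the fractional part of [y],

      [x * E u = sum_d g d * ({x} / d - {x / d})].

    Upper bound. The bracket is at most [min 1 (x / d) <= (x / d) ^ s], where
    [s = 1 - xi / ln z] (Rankin's trick), so [|E u|] is at most
    [exp (- xi * u)] times the sum of [|g d| d ^ -s]. That sum is an Euler product
    whose factor at [p] is at most [exp ((1 - f p) p ^ -s + 5 p ^ (-2 s))].

    Oscillation. The function [W u = exp (xi * u) E u] is a finite combination of
    translates, by [ln d / ln z], of the single integrable function [sawtooth]. Its
    Fourier transform over the whole line is therefore, up to sign, the transform of
    [sawtooth] times [G - G1], where [G] is the Dirichlet polynomial of [g] at
    [1 - (xi + i theta) / ln z], [theta] being the frequency.
    - At frequency [0] we have [0 <= G <= 1], and the integral of [W] is at most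
      [3 / xi] in absolute value ([mean_discrepancy], [sum_terms_itv]).
    - At frequency [pi] a prime [p] near [z] gets the phase [p ^ (i pi / ln z)], which
      is close to [-1]: the Euler factors, which would be small at frequency [0],
      become large, and [|G| >= X := exp (H - 5 H2 - 5 J)] ([normc_sum_terms_ge_H]).
      The cosine moment of [sawtooth] is at least [0.49 / xi] ([cos_moment_lower]).
    So the integral of [|W|] is about [X / xi] while that of [W] is much smaller, and
    each sign of [W] carries a mass of order [X / xi]. Outside the interval
    [H (1 - 2 tau) <= u <= H (1 + 2 tau)] the weight [exp (xi * u)] is compared with
    [exp ((xi + tau) * u)] on the right and [exp ((xi - tau) * u)] on the left; the
    definition of [tau] makes the mass there at most [X / (10 xi)]
    ([line_integral_tails]). As the interval has length at most [2 H], both signs must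
    reach [X / (20 xi H)] inside it ([large_value]). *)

Import Order.TTheory GRing.Theory Num.Theory.
Import numFieldNormedType.Exports Normc.
Set Implicit Arguments.
Unset Strict Implicit.
Unset Printing Implicit Defensive.
Local Open Scope classical_set_scope.
Local Open Scope ring_scope.

(** * Bounds for the exponential, the cosine and pi *)

Section ElementaryInequalities.
Context {R : realType}.
Implicit Types x y t : R.

Lemma le_of_derive_ge0 (F dF : R -> R) :
  (forall x, is_derive x 1 F (dF x)) -> (forall x, 0 <= x -> 0 <= dF x) ->
  forall x, 0 <= x -> F 0 <= F x.
Proof.
move=> HF HdF x x0.
have Fc : continuous F.
  by move=> y; apply: differentiable_continuous; apply/derivable1_diffP; case: (HF y).
apply: (@ger0_derive1_ndecry _ F 0); rewrite ?lexx //.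
- move=> y; rewrite in_itv /= andbT => y0; have dFy := HF y.
  by rewrite derive1E derive_val; exact: HdF (ltW y0).
- by apply: continuous_subspaceT.
Qed.

Lemma expR_ge_quadratic x : 0 <= x -> 1 + x + x ^+ 2 / 2 <= expR x.
Proof.
move=> x0.
have H := @le_of_derive_ge0 (fun y => expR y - (1 + y + y ^+ 2 / 2)) (fun y => expR y - (1 + y)).
rewrite expR0 in H.
suff : 1 - (1 + 0 + 0 ^+ 2 / 2) <= expR x - (1 + x + x ^+ 2 / 2) by rewrite expr0n /=; lra.
apply: H => //.
  move=> y; apply: is_derive_eq.
  by rewrite /GRing.scale /=; field.
by move=> y _; have := expR_ge1Dx y; lra.
Qed.

Lemma expRN_le_quadratic x : 0 <= x -> expR (- x) <= 1 - x + x ^+ 2 / 2.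
Proof.
move=> x0; have h := expR_ge_quadratic x0.
rewrite expRN; have h0 : 0 < 1 + x + x ^+ 2 / 2 by nra.
apply: (@le_trans _ _ (1 + x + x ^+ 2 / 2)^-1).
  by rewrite lef_pV2 // posrE // expR_gt0.
rewrite -div1r ler_pdivrMr //.
have : 0 <= x ^+ 4 by rewrite exprn_even_ge0.
rewrite !exprS expr0; nra.
Qed.

(** Take inverses in the [n.+1]-st power of [1 - x / n.+1 <= expR (- x / n.+1)]. *)
Lemma expR_le_inv n x : x < n.+1%:R -> expR x <= ((1 - x / n.+1%:R) ^+ n.+1)^-1.
Proof.
move=> xn.
have n0 : (0 : R) < n.+1%:R by rewrite ltr0n.
have h : 0 < 1 - x / n.+1%:R by rewrite subr_gt0 ltr_pdivrMr // mul1r.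
rewrite -[x in expR x]opprK expRN lef_pV2 ?posrE ?expR_gt0 ?exprn_gt0 //.
have -> : - x = n.+1%:R * (- (x / n.+1%:R)) by field.
rewrite expRM_natl lerXn2r ?nnegrE ?expR_ge0 ?(ltW h) //.
exact: expR_ge1Dx.
Qed.

Lemma expR_le_1DDsqr x : -1 <= x -> x <= 1 / 2 -> expR x <= 1 + x + x ^+ 2.
Proof.
move=> x0 x1; apply: le_trans (expR_le_inv (n := 2) _) _; first by lra.
have h : 0 < 1 - x / 3 by lra.
rewrite -div1r ler_pdivrMr ?exprn_gt0 //.
have h2 : 0 <= x ^+ 2 * (9 - 19 * x + 8 * x ^+ 2 - x ^+ 3).
  by rewrite mulr_ge0 ?sqr_ge0 // !exprS expr0; nra.
rewrite -subr_ge0.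
have -> : (1 + x + x ^+ 2) * (1 - x / 3) ^+ 3 - 1 =
  x ^+ 2 * (9 - 19 * x + 8 * x ^+ 2 - x ^+ 3) / 27 by field.
by rewrite divr_ge0.
Qed.

Lemma expR1_le : expR 1 <= 14 / 5 :> R.
Proof.
have -> : expR 1 = expR (20%:R * (1 / 20)) :> R by congr expR; field.
rewrite expRM_natl.
have h : expR (1 / 20) <= 20 / 19 :> R.
  apply: le_trans (expR_le_inv (n := 0) _) _; first by lra.
  by rewrite expr1 divr1 invf_ple ?posrE; lra.
apply: (le_trans (lerXn2r 20 _ _ h)); rewrite ?nnegrE ?expR_ge0 //; lra.
Qed.

Lemma expR5_ge : 80 <= expR 5 :> R.
Proof.
have -> : (5 : R) = 20%:R * (1 / 4) by field.
rewrite expRM_natl.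
have h : 5 / 4 <= expR (1 / 4) :> R by have := expR_ge1Dx (1 / 4 : R); lra.
apply: le_trans (lerXn2r 20 _ _ h); rewrite ?nnegrE ?expR_ge0 //; lra.
Qed.

Lemma cos_ge_quadratic x : 1 - x ^+ 2 / 2 <= cos x.
Proof.
wlog x0 : x / 0 <= x.
  move=> H; have [|x0] := leP 0 x; first exact: H.
  by rewrite -cosN -sqrrN; apply: H; rewrite oppr_ge0 ltW.
have sinx y : 0 <= y -> 0 <= y - sin y.
  move=> y0; rewrite -[leLHS](_ : 0 - sin 0 = 0); last by rewrite sin0 subr0.
  apply: (@le_of_derive_ge0 (fun y => y - sin y) (fun y => 1 - cos y)) => //.
have := @le_of_derive_ge0 (fun y => cos y - (1 - y ^+ 2 / 2)) (fun y => y - sin y) _ _ x x0.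
rewrite cos0 expr0n /= => H; rewrite -subr_ge0; apply: le_trans (H _ sinx); first by lra.
by move=> y; apply: is_derive_eq; rewrite /GRing.scale /=; field.
Qed.

Lemma cos_le_quartic x : 0 <= x -> cos x <= 1 - x ^+ 2 / 2 + x ^+ 4 / 24.
Proof.
move=> x0.
have sinx y : 0 <= y -> 0 <= sin y - (y - y ^+ 3 / 6).
  move=> y0.
  have := @le_of_derive_ge0 (fun y => sin y - (y - y ^+ 3 / 6))
            (fun y => cos y - (1 - y ^+ 2 / 2)) _ _ y y0.
  rewrite sin0 expr0n /= mul0r !subr0; apply.
    by move=> z; apply: is_derive_eq; rewrite /GRing.scale /=; field.
  by move=> z _; rewrite subr_ge0 cos_ge_quadratic.
have := @le_of_derive_ge0 (fun y => (1 - y ^+ 2 / 2 + y ^+ 4 / 24) - cos y)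
          (fun y => sin y - (y - y ^+ 3 / 6)) _ sinx x x0.
rewrite cos0 !expr0n /= => H; rewrite -subr_ge0; apply: le_trans (H _); first by lra.
by move=> y; apply: is_derive_eq; rewrite /GRing.scale /=; field.
Qed.

(** If [pi ^+ 2 > 10] then [y = sqrt (5 / 8)] is less than [pi / 4], whereas the quartic
    bound gives [cos y ^+ 2 < 1 / 2 = cos (pi / 4) ^+ 2]. *)
Lemma sqr_pi_le10 : pi ^+ 2 <= 10 :> R.
Proof.
rewrite leNgt; apply/negP => pi10.
have p0 := @pi_gt0 R.
pose y : R := Num.sqrt (5 / 8).
have y0 : 0 <= y by exact: sqrtr_ge0.
have y2 : y ^+ 2 = 5 / 8 by rewrite sqr_sqrtr //; lra.
have ypi : y < pi / 4.
  by rewrite -(@ltr_pXn2r _ 2) ?nnegrE // ?divr_ge0 ?(ltW p0) // y2 exprMn; lra.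
have c4 : cos (pi / 4) ^+ 2 *+ 2 - 1 = 0 :> R.
  by rewrite -cos_mulr2n -cos_pihalf; congr cos; field.
have c40 : 0 <= cos (pi / 4) :> R by apply: cos_ge0_pihalf; apply/andP; split; lra.
have : cos (pi / 4) < cos y :> R.
  by rewrite ltr_cos // in_itv /=; apply/andP; split; lra.
have := cos_le_quartic y0; rewrite (exprM y 2 2) y2; move: c4.
rewrite mulr2n; nra.
Qed.

(** The constant [5 >= pi ^+ 2 / 2] is the coefficient of [Hj 2] in the final bounds. *)
Lemma cos_pi_ge t : 1 - 5 * t ^+ 2 <= cos (pi * t).
Proof.
apply: le_trans (cos_ge_quadratic _); rewrite exprMn.
by have := sqr_pi_le10; have := sqr_ge0 t; nra.
Qed.
End ElementaryInequalities.

(** * Euler factors *)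

Section LocalFactor.
Context {R : realType}.
Implicit Types (f : nat -> R) (t : R) (w : R[i]) (a : nat).

(** The values at the powers [p ^ k] of the Moebius transform of an arithmetic function
    whose value at [p ^ k] is [f k]. *)
Definition jump f k : R := if k is j.+1 then f k - f j else f 0%N.

Lemma normc_sum (I : Type) (r : seq I) (P : pred I) (F : I -> R[i]) :
  normc (\sum_(i <- r | P i) F i) <= \sum_(i <- r | P i) normc (F i).
Proof.
elim/big_rec2: _ => [|i y x _ IH]; first by rewrite normc0.
by apply: le_trans (le_normcD _ _) _; rewrite lerD2l.
Qed.

Lemma normcX w n : normc (w ^+ n) = normc w ^+ n.
Proof. by elim: n => [|n IH]; rewrite ?expr0 ?normc1 // !exprS normcM IH. Qed.

Lemma normc_ge0 w : 0 <= normc w.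
Proof. by case: w => x y; exact: sqrtr_ge0. Qed.

Lemma normc_real t : normc (t%:C)%C = `|t|.
Proof. by rewrite /normc /= expr0n /= addr0 sqrtr_sqr. Qed.

Lemma normc_ge_Re w : `|complex.Re w| <= normc w.
Proof.
by case: w => x y; rewrite /normc /= -sqrtr_sqr ler_wsqrtr // lerDl sqr_ge0.
Qed.

Lemma sum_geometric_le t a : 0 <= t < 1 -> \sum_(i < a) t ^+ i <= (1 - t)^-1.
Proof.
move=> /andP[t0 t1]; have t1' : 0 < 1 - t by rewrite subr_gt0.
rewrite -[leRHS]mul1r ler_pdivlMr // mulrC -opprB mulNr -subrX1 opprB.
by rewrite lerBlDr lerDl exprn_ge0.
Qed.

Lemma sum_derivative_geometric_le t a : 0 <= t < 1 ->
  \sum_(i < a.+1) i%:R * t ^+ i.-1 <= ((1 - t) ^+ 2)^-1.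
Proof.
move=> /andP[t0 t1]; have t1' : 0 < (1 - t) ^+ 2 by rewrite exprn_gt0 // subr_gt0.
rewrite -[leRHS]mul1r ler_pdivlMr //.
have -> : (\sum_(i < a.+1) i%:R * t ^+ i.-1) * (1 - t) ^+ 2 =
    1 - (a.+1%:R * t ^+ a - a%:R * t ^+ a.+1).
  elim: a => [|a IH]; first by rewrite big_ord1 /= !mul0r mul1r !subr0 expr0; ring.
  rewrite big_ord_recr /= mulrDl IH -!natr1 !exprS; ring.
rewrite lerBlDr lerDl subr_ge0 exprS mulrA ler_wpM2r ?exprn_ge0 //.
by rewrite -natr1 -[leRHS]mulr1; have : 0 <= a%:R :> R by []; nra.
Qed.

Section Bounded.
Variable f : nat -> R.
Hypothesis f0 : f 0%N = 1.
Hypothesis f01 : forall k, 0 <= f k <= 1.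

Lemma norm_jump_le1 k : `|jump f k| <= 1.
Proof.
case: k => [|k] /=; first by rewrite f0 normr1.
by have := f01 k; have := f01 k.+1; rewrite ler_norml => /andP[? ?] /andP[? ?]; lra.
Qed.

Lemma sum_jump_split (S : pzRingType) (F : nat -> S) a :
  \sum_(k < a.+2) F k = F 0%N + F 1%N + \sum_(k < a) F k.+2.
Proof. by rewrite !big_ord_recl /= addrA. Qed.

(** The terms with [k >= 2] add up to at most [t ^+ 2 / (1 - t)], hence the constant [5]
    for [t <= 4 / 5]. *)
Lemma sum_norm_jump_le t a : 0 <= t -> t <= 4 / 5 -> 
  \sum_(k < a.+2) `|jump f k| * t ^+ k <= expR ((1 - f 1%N) * t + 5 * t ^+ 2).
Proof.
move=> t0 t1; apply: le_trans (expR_ge1Dx _).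
rewrite (sum_jump_split (fun k => `|jump f k| * t ^+ k)) /= f0 normr1 expr0 mulr1 expr1.
rewrite distrC ger0_norm; last by have /andP[] := f01 1; lra.
rewrite -addrA lerD2l lerD2l.
apply: (@le_trans _ _ (t ^+ 2 * \sum_(k < a) t ^+ k)).
  rewrite mulr_sumr; apply: ler_sum => k _.
  by rewrite -exprD ler_piMl ?exprn_ge0 // (norm_jump_le1 k.+2).
rewrite mulrC ler_wpM2r ?sqr_ge0 //.
apply: le_trans (sum_geometric_le _ _) _; first by apply/andP; split; lra.
by rewrite invf_ple ?posrE; lra.
Qed.

(** Abel summation writes the sum as a combination of the [f k] with nonnegative
    coefficients of total mass one, where [f 0 = 1] has weight at least [1 - t]. *)
Lemma sum_jump_itv t a : 0 <= t <= 1 ->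
  1 - t <= \sum_(k < a.+1) jump f k * t ^+ k <= 1.
Proof.
move=> /andP[t0 t1].
have E b : \sum_(k < b.+1) jump f k * t ^+ k =
    \sum_(k < b) f k * (t ^+ k * (1 - t)) + f b * t ^+ b.
  elim: b => [|b IH]; first by rewrite big_ord1 big_ord0 /= add0r.
  by rewrite big_ord_recr IH [in RHS]big_ord_recr /= exprS; ring.
have T b : \sum_(k < b) (t ^+ k * (1 - t)) = 1 - t ^+ b.
  by rewrite -mulr_suml mulrC -opprB mulNr -subrX1 opprB.
apply/andP; split; last first.
  rewrite E -[leRHS](subrK (t ^+ a)) -T lerD //.
    apply: ler_sum => k _; rewrite ler_piMl //; last by have /andP[] := f01 k.
    by rewrite mulr_ge0 ?exprn_ge0 // subr_ge0.
  by rewrite ler_piMl ?exprn_ge0 //; have /andP[] := f01 a.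
case: a => [|a]; first by rewrite big_ord1 /= f0 expr0 mulr1 lerBlDr lerDl.
rewrite E big_ord_recl /= f0 mul1r expr0 mul1r -addrA lerDl addr_ge0 //.
  apply: sumr_ge0 => k _; rewrite mulr_ge0 //; first by have /andP[] := f01 (bump 0 k).
  by rewrite mulr_ge0 ?exprn_ge0 // subr_ge0.
by rewrite mulr_ge0 ?exprn_ge0 //; have /andP[] := f01 a.+1.
Qed.

(** The first two terms have real part [1 + x], with [x = - (1 - f 1) * Re w], and the
    others cost at most [3 / 2 * t ^+ 2], where [t = normc w]. What remains is
    [1 + x + x ^+ 2 <= (1 + x - 3 / 2 * t ^+ 2) * (1 + 5 * t ^+ 2)]; for [x = - t] it reduces
    to [(1 - 3 * t) * (1 + t) >= 0], which is where the range [t <= 1 / 3] comes from. *)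
Lemma normc_sum_jump_ge_small w a : normc w <= 1 / 3 ->
  expR (- ((1 - f 1%N) * complex.Re w) - 5 * normc w ^+ 2) <=
  normc (\sum_(k < a.+2) (jump f k)%:C%C * w ^+ k).
Proof.
set t : R := normc w => t3.
have t0 : 0 <= t by exact: normc_ge0.
rewrite (sum_jump_split (fun k => (jump f k)%:C%C * w ^+ k)) /= expr0 expr1 mulr1 f0.
set r := \sum_(k < a) _.
have rle : normc r <= 3 / 2 * t ^+ 2.
  apply: le_trans (normc_sum _ _ _) _.
  apply: (@le_trans _ _ (t ^+ 2 * \sum_(k < a) t ^+ k)).
    rewrite mulr_sumr; apply: ler_sum => k _.
    rewrite normcM normcX normc_real -exprD ler_piMl ?exprn_ge0 //.
    exact: (norm_jump_le1 k.+2).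
  rewrite mulrC ler_wpM2r ?sqr_ge0 //.
  apply: le_trans (sum_geometric_le _ _) _; first by apply/andP; split; lra.
  by rewrite invf_ple ?posrE; lra.
set x := - ((1 - f 1%N) * complex.Re w).
have xt : `|x| <= t.
  rewrite /x normrN normrM; apply: le_trans (normc_ge_Re w).
  by rewrite ler_piMl // ger0_norm; have /andP[] := f01 1; lra.
have xs : x ^+ 2 <= t ^+ 2 by rewrite -[x ^+ 2]real_normK ?num_real // lerXn2r ?nnegrE.
move: xt; rewrite ler_norml => /andP[xt1 xt2].
have main : 1 + x <= normc (1%:C%C + (f 1%N - 1)%:C%C * w).
  apply: le_trans (ler_norm _) _; apply: le_trans (normc_ge_Re _).
  rewrite le_eqVlt; apply/orP; left.
  by apply/eqP; congr `|_|; rewrite /x; case: (w) => u v /=; ring.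
have {main rle} main : 1 + x - 3 / 2 * t ^+ 2 <= normc (1%:C%C + (f 1%N - 1)%:C%C * w + r).
  rewrite lerBlDr; apply: le_trans main _.
  have -> : 1%:C%C + (f 1%N - 1)%:C%C * w = (1%:C%C + (f 1%N - 1)%:C%C * w + r) + - r.
    by rewrite addrK.
  apply: le_trans (le_normcD _ _) _.
  by rewrite normcN addrK lerD2l.
apply: le_trans main.
rewrite expRB ler_pdivrMr ?expR_gt0 //.
apply: le_trans (expR_le_1DDsqr _ _) _; [lra|lra|].
have h5 : 1 + 5 * t ^+ 2 <= expR (5 * t ^+ 2) by exact: expR_ge1Dx.
have t2 : 0 <= t ^+ 2 by exact: sqr_ge0.
have tt : t ^+ 2 <= 1 / 9 by rewrite expr2; nra.
apply: (@le_trans _ _ ((1 + x - 3 / 2 * t ^+ 2) * (1 + 5 * t ^+ 2))); last first.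
  by rewrite ler_wpM2l //; lra.
have h1 : 0 <= t ^+ 2 * ((1 - 3 * t) * (1 + t)) by rewrite mulr_ge0 // mulr_ge0; lra.
have h2 : 0 <= t ^+ 2 * (x + t) by rewrite mulr_ge0; lra.
rewrite -subr_ge0.
have -> : (1 + x - 3 / 2 * t ^+ 2) * (1 + 5 * t ^+ 2) - (1 + x + x ^+ 2) =
  5 / 2 * (t ^+ 2 * ((1 - 3 * t) * (1 + t))) + 5 * (t ^+ 2 * (x + t)) + (t ^+ 2 - x ^+ 2).
  by field.
by lra.
Qed.

Lemma normc_subX_le w t k : normc w = t -> 0 <= t ->
  normc (w ^+ k - t%:C%C ^+ k) <= k%:R * t ^+ k.-1 * normc (w - t%:C%C).
Proof.
move=> wt t0; elim: k => [|k IH]; first by rewrite !expr0 subrr normc0 mul0r mul0r.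
have -> : w ^+ k.+1 - t%:C%C ^+ k.+1 = w * (w ^+ k - t%:C%C ^+ k) + (w - t%:C%C) * t%:C%C ^+ k.
  by rewrite !exprS; ring.
apply: le_trans (le_normcD _ _) _.
rewrite !normcM wt normcX normc_real ger0_norm //=.
rewrite -natr1 mulrDl mul1r mulrDl [X in _ <= _ + X]mulrC lerD2r.
apply: le_trans (ler_wpM2l t0 IH) _; rewrite mulrA mulrCA.
by case: k {IH} => [|k] /=; rewrite ?mul0r // -exprS.
Qed.

(** The sum is within [1 / 100] of its value at the positive real [t = normc w], which is
    at least [1 - t]. Since [Re w >= 0], the left-hand side is at most
    [expR (- 5 * t ^+ 2)], which on this range is below [0.95 * (1 - t)]. *)
Lemma normc_sum_jump_ge_near_real w a : 1 / 3 <= normc w <= 4 / 5 ->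
  0 <= complex.Re w -> normc (w - (normc w)%:C%C) <= 1 / 2500 ->
  expR (- ((1 - f 1%N) * complex.Re w) - 5 * normc w ^+ 2) <=
  normc (\sum_(k < a.+1) (jump f k)%:C%C * w ^+ k).
Proof.
set t : R := normc w => /andP[t3 t5] Rew wt.
have t0 : 0 <= t by exact: normc_ge0.
have /(sum_jump_itv a)/andP[h1 _] : 0 <= t <= 1 by apply/andP; split; lra.
have err : normc (\sum_(k < a.+1) (jump f k)%:C%C * (w ^+ k - t%:C%C ^+ k)) <= 1 / 100.
  apply: le_trans (normc_sum _ _ _) _.
  apply: (@le_trans _ _ (\sum_(k < a.+1) (k%:R * t ^+ k.-1) * normc (w - t%:C%C))).
    apply: ler_sum => k _; rewrite normcM normc_real.
    apply: le_trans (normc_subX_le _ (erefl _) t0).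
    by rewrite ler_piMl ?normc_ge0 // norm_jump_le1.
  rewrite -mulr_suml.
  have h : \sum_(i < a.+1) i%:R * t ^+ i.-1 <= 25.
    apply: le_trans (sum_derivative_geometric_le _ _) _; first by apply/andP; split; lra.
    by rewrite invf_ple ?posrE ?exprn_gt0 ?expr2; nra.
  apply: (@le_trans _ _ (25 * (1 / 2500))); last by lra.
  apply: ler_pM => //; first by apply: sumr_ge0 => i _; rewrite mulr_ge0 // exprn_ge0.
  exact: normc_ge0.
have main : 95 / 100 * (1 - t) <= normc (\sum_(k < a.+1) (jump f k)%:C%C * w ^+ k).
  have E : (\sum_(k < a.+1) jump f k * t ^+ k)%:C%C =
      \sum_(k < a.+1) (jump f k)%:C%C * w ^+ k
      - \sum_(k < a.+1) (jump f k)%:C%C * (w ^+ k - t%:C%C ^+ k).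
    rewrite rmorph_sum -sumrB; apply: eq_bigr => k _.
    by rewrite rmorphM rmorphXn /=; ring.
  have : `|\sum_(k < a.+1) jump f k * t ^+ k| <=
      normc (\sum_(k < a.+1) (jump f k)%:C%C * w ^+ k) + 1 / 100.
    rewrite -normc_real E; apply: le_trans (le_normcD _ _) _.
    by rewrite normcN lerD2l.
  rewrite ger0_norm; last by lra.
  by move=> ?; lra.
apply: le_trans main.
apply: (@le_trans _ _ (expR (- (5 * t ^+ 2)))).
  rewrite ler_expR; have /andP[_ f1] := f01 1.
  by have : 0 <= (1 - f 1%N) * complex.Re w; [rewrite mulr_ge0 //; lra | lra].
rewrite expRN -div1r ler_pdivrMr ?expR_gt0 //.
have e2 : (1 + 5 / 2 * t ^+ 2) ^+ 2 <= expR (5 * t ^+ 2).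
  have -> : 5 * t ^+ 2 = 2%:R * (5 / 2 * t ^+ 2) by field.
  rewrite expRM_natl lerXn2r ?nnegrE ?expR_ge0 ?expR_ge1Dx //.
  by have := sqr_ge0 t; lra.
apply: (@le_trans _ _ (95 / 100 * (1 - t) * (1 + 5 / 2 * t ^+ 2) ^+ 2)); last first.
  by rewrite ler_wpM2l //; lra.
set u := 1 + 5 / 2 * t ^+ 2.
(* The convex function [u ^+ 2] of [t] lies above its tangent lines; those at [7 / 20]
   and [3 / 5] suffice to the left and to the right of [1 / 2]. *)
have tangent t1 : (1 + 5 / 2 * t1 ^+ 2) ^+ 2
    + 10 * t1 * (1 + 5 / 2 * t1 ^+ 2) * (t - t1) <= u ^+ 2.
  have h2 : 0 <= 5 * (1 + 5 / 2 * t1 ^+ 2) * (t - t1) ^+ 2.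
    by have := sqr_ge0 t1; have := sqr_ge0 (t - t1) => ? ?; rewrite mulr_ge0 //; lra.
  have h4 : 0 <= (u - (1 + 5 / 2 * t1 ^+ 2)) ^+ 2 by exact: sqr_ge0.
  rewrite -subr_ge0; apply: le_trans (addr_ge0 h2 h4) _; rewrite le_eqVlt; apply/orP; left.
  by apply/eqP; rewrite /u; field.
have [t2|t2] := leP t (1 / 2).
  by have := tangent (7 / 20); nra.
by have := tangent (3 / 5); nra.
Qed.
End Bounded.
End LocalFactor.

(** * Expansion over the divisors of q *)

Section DivisorExpansion.
Context {R : realType}.
Implicit Types (g : nat -> nat -> R) (a : nat -> nat) (s : seq nat).

(** The pairs [(d, g d)] for the products [d] of prime powers [p ^ k] with [p] in [s] and
    [k <= a p]. Recursion on the list of primes makes the Euler product formula an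
    immediate induction. *)
Fixpoint divisor_terms g a s : seq (nat * R) :=
  if s is p :: s' then
    [seq ((p ^ k * t.1)%N, g p k * t.2) |
      k <- iota 0 (a p).+1, t <- divisor_terms g a s']
  else [:: (1%N, 1)].

Lemma big_divisor_terms_cons (S : nmodType) g a p s (F : nat * R -> S) :
  \sum_(t <- divisor_terms g a (p :: s)) F t =
  \sum_(k < (a p).+1) \sum_(t <- divisor_terms g a s) F ((p ^ k * t.1)%N, g p k * t.2).
Proof.
rewrite big_allpairs_dep /=.
rewrite -(big_mkord xpredT (fun k =>
  \sum_(t <- divisor_terms g a s) F ((p ^ k * t.1)%N, g p k * t.2))).
by rewrite /index_iota subn0.
Qed.

Lemma divisor_terms_coprime g a s r t : prime r -> all prime s -> r \notin s ->
  t \in divisor_terms g a s -> coprime r t.1.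
Proof.
move=> pr; elim: s t => [|p s IH] t.
  by move=> _ _; rewrite inE => /eqP -> /=; rewrite coprimen1.
move=> /andP[pp ps]; rewrite inE negb_or => /andP[rp rs].
move=> /allpairsP [[k u]] [_ us ->] /=.
rewrite coprimeMr IH // andbT coprimeXr //.
by rewrite prime_coprime // dvdn_prime2.
Qed.

Lemma divisor_terms_gt0 g a s t : all prime s ->
  t \in divisor_terms g a s -> (0 < t.1)%N.
Proof.
elim: s t => [|p s IH] t; first by rewrite inE => _ /eqP ->.
move=> /andP[pp ps].
move=> /allpairsP [[k u]] [_ us ->] /=.
by rewrite muln_gt0 expn_gt0 prime_gt0 //= IH.
Qed.

(** Below, [phi] is the identity, the absolute value or the embedding into the complex
    numbers. Only multiplicativity of [h] on coprime arguments is asked for, so that [h]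
    can also be the indicator function of the divisors of an integer. *)
Lemma euler_product (S : comPzRingType) g a s (phi : R -> S) (h : nat -> S) :
  phi 1 = 1 -> {morph phi : x y / x * y} -> h 1%N = 1 ->
  (forall m n, (0 < m)%N -> (0 < n)%N -> coprime m n -> h (m * n)%N = h m * h n) ->
  uniq s -> all prime s ->
  \sum_(t <- divisor_terms g a s) phi t.2 * h t.1 =
  \prod_(p <- s) \sum_(k < (a p).+1) phi (g p k) * h (p ^ k)%N.
Proof.
move=> phi1 phiM h1 hM.
elim: s => [|p s IH]; first by rewrite big_nil big_seq1 /= phi1 h1 mulr1.
move=> /= /andP[ps us] /andP[pp pps].
rewrite big_divisor_terms_cons big_cons -IH // mulr_suml.
apply: eq_bigr => k _; rewrite mulr_sumr; apply: eq_big_seq => t ts /=.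
rewrite phiM hM ?expn_gt0 ?(prime_gt0 pp) ?(divisor_terms_gt0 pps ts) //; first by rewrite mulrACA.
  by rewrite coprimeXl // (divisor_terms_coprime pp pps ps ts).
Qed.

Lemma multiplicative_prod (f : nat -> R) (e : nat -> nat) s :
  multiplicative_function f -> uniq s -> all prime s ->
  f (\prod_(p <- s) p ^ e p)%N = \prod_(p <- s) f (p ^ e p)%N.
Proof.
move=> [f1 fM]; elim: s => [|p s IH]; first by rewrite !big_nil.
move=> /= /andP[ps us] /andP[pp pps]; rewrite !big_cons fM ?IH //.
- by rewrite expn_gt0 prime_gt0.
- rewrite big_seq prodn_cond_gt0 // => r rs.
  by rewrite expn_gt0 prime_gt0 // (allP pps).
- rewrite coprimeXl // big_seq; elim/big_ind: _ => [|x y|r rs]; first exact: coprimen1.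
    by rewrite coprimeMr => -> ->.
  have pr : p != r by apply: contraNneq ps => ->.
  by rewrite coprimeXr // prime_coprime // dvdn_prime2 // (allP pps).
Qed.

Lemma gcdn_prod_primes (n q : nat) : (0 < n)%N -> (0 < q)%N ->
  gcdn n q = (\prod_(p <- primes q) p ^ minn (logn p q) (logn p n))%N.
Proof.
move=> n0 q0.
have P0 (s : seq nat) e : all prime s -> (0 < \prod_(p <- s) p ^ e p)%N.
  move=> sp; rewrite big_seq prodn_cond_gt0 // => r rs.
  by rewrite expn_gt0 prime_gt0 // (allP sp).
have pq : all prime (primes q) by apply/allP => p; rewrite mem_primes => /andP[].
apply: eqn_from_log; [by rewrite gcdn_gt0 n0|exact: P0|] => r.
rewrite logn_gcd // minnC.
have L (s : seq nat) e : all prime s -> uniq s ->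
    logn r (\prod_(p <- s) p ^ e p)%N = if r \in s then e r else 0%N.
  elim: s => [|p s IH]; first by rewrite big_nil logn1.
  move=> /= /andP[pp ps] /andP[pns us]; rewrite big_cons lognM ?P0 ?expn_gt0 ?prime_gt0 //.
  rewrite IH // lognX logn_prime // inE; have [->|_] := eqVneq r p.
    by rewrite muln1 (negbTE pns) addn0.
  by rewrite muln0.
rewrite L ?primes_uniq //; case: ifP => // /negbT.
rewrite -logn_gt0 -eqn0Ngt => /eqP ->.
by rewrite min0n.
Qed.

Section Expansion.
Variables (q : nat) (f : nat -> R).
Hypotheses (q0 : (0 < q)%N) (adm : admissible q f).

Definition local_jump p k : R := jump (fun k => f (p ^ k)%N) k.

(** The graph of the Moebius transform of [f] on the divisors of [q]. *)
Definition terms := divisor_terms local_jump (logn^~ q) (primes q).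

Lemma primes_prime : all prime (primes q).
Proof. by apply/allP => p; rewrite mem_primes => /andP[]. Qed.

Lemma terms_gt0 t : t \in terms -> (0 < t.1)%N.
Proof. exact/divisor_terms_gt0/primes_prime. Qed.

Lemma sum_jump_cut (F : nat -> R) (a v : nat) :
  \sum_(k < a.+1) jump F k * (k <= v)%:R = F (minn a v).
Proof.
elim: a => [|a IH]; first by rewrite big_ord1 /= mulr1 min0n.
rewrite big_ord_recr IH /=; have [av|va] := leqP a.+1 v.
  by rewrite mulr1 addrC (minn_idPl (ltnW av)) subrK.
by rewrite mulr0 addr0; move: va; rewrite ltnS => /minn_idPr ->.
Qed.

(** The factor at [p] of the Euler product telescopes to [f (p ^ k)] with [p ^ k] the
    [p]-part of [gcdn n q]. *)
Lemma f_eq_sum_terms n : (0 < n)%N ->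
  f n = \sum_(t <- terms) t.2 * (t.1 %| n)%:R.
Proof.
move=> n0; case: (adm) => fm _ _ fgcd.
rewrite (@euler_product _ _ _ _ id (fun d => (d %| n)%:R)) ?primes_uniq ?primes_prime //.
- rewrite fgcd // gcdn_prod_primes // multiplicative_prod ?primes_uniq ?primes_prime //.
  apply: eq_big_seq => p; rewrite mem_primes => /andP[pp _].
  rewrite -(sum_jump_cut (fun k => f (p ^ k)%N)).
  by apply: eq_bigr => k _; rewrite pfactor_dvdn.
- by rewrite dvd1n.
- by move=> m k m0 k0 mk; rewrite Gauss_dvd // -mulnb natrM.
Qed.

Lemma f_prime_power_bounds p k : prime p -> 0 <= f (p ^ k)%N <= 1.
Proof. by move=> pp; case: (adm) => _ _ + _; apply; rewrite expn_gt0 prime_gt0. Qed.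

(** For [k] at least the exponent of [p] in [q], the gcd of [p ^ k] and [q] does not depend
    on [k]. *)
Lemma local_jump_eq0 p k : prime p -> (logn p q < k)%N -> local_jump p k = 0.
Proof.
move=> pp; case: k => // k ak; rewrite /local_jump /=; case: (adm) => _ _ _ fgcd.
have gcdE j : (logn p q <= j)%N -> gcdn (p ^ j) q = (p ^ logn p q)%N.
  move=> aj; apply: eqn_from_log; rewrite ?gcdn_gt0 ?expn_gt0 ?(prime_gt0 pp) //.
  move=> r; rewrite logn_gcd ?expn_gt0 ?(prime_gt0 pp) // !lognX logn_prime //.
  have [->|_] := eqVneq r p; last by rewrite !muln0 min0n.
  by rewrite !muln1; apply/minn_idPr.
rewrite fgcd ?expn_gt0 ?prime_gt0 // [f (p ^ k)%N]fgcd ?expn_gt0 ?prime_gt0 //.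
by rewrite !gcdE ?subrr // ltnW.
Qed.

(** Multiplication by [1 - p^-1] turns the coefficients [f (p ^ k)] into their jumps, and
    these vanish beyond the exponent of [p] in [q]. *)
Lemma G1_local p : prime p ->
  (1 - p%:R^-1) * (1 + limn (series (fun k : nat => f (p ^ k.+1)%N / p%:R ^+ k.+1)))
  = \sum_(k < (logn p q).+1) local_jump p k * p%:R^-1 ^+ k :> R.
Proof.
move=> pp; set y : R := p%:R^-1; set S := RHS.
have y1 : `|y| < 1.
  rewrite ger0_norm ?invr_ge0 // invf_lt1 ?ltr0n ?prime_gt0 // ltr1n.
  exact: prime_gt1.
have yn1 : 1 - y != 0 by rewrite subr_eq0 eq_sym; apply: contraTneq y1 => ->; rewrite normr1 ltxx.
have f1 : f (p ^ 0)%N = 1 by case: (adm) => -[].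
have E n : (1 - y) * (1 + series (fun k : nat => f (p ^ k.+1)%N / p%:R ^+ k.+1) n) =
    \sum_(k < n.+1) local_jump p k * y ^+ k - f (p ^ n)%N * y ^+ n.+1.
  rewrite /series /= big_mkord.
  elim: n => [|n IH]; first by rewrite big_ord0 big_ord1 /= /local_jump /jump f1; ring.
  rewrite big_ord_recr big_ord_recr /= addrA mulrDr {}IH /local_jump /=.
  by rewrite -exprVn -/y !exprS; ring.
have cv : series (fun k : nat => f (p ^ k.+1)%N / p%:R ^+ k.+1) @ \oo --> S / (1 - y) - 1.
  have -> : series (fun k : nat => f (p ^ k.+1)%N / p%:R ^+ k.+1) =
      (fun n => (\sum_(k < n.+1) local_jump p k * y ^+ k - f (p ^ n)%N * y ^+ n.+1) / (1 - y) - 1).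
    by apply/funext => n; rewrite -E; field.
  apply: cvgB; last exact: cvg_cst.
  apply: cvgMr_tmp; rewrite -[S]subr0; apply: cvgB.
    apply: cvg_near_cst; near=> n.
    have an : (logn p q <= n)%N by near: n; exact: nbhs_infty_ge.
    rewrite /S -(subnKC an) -addSn big_split_ord.
    rewrite -[RHS]addr0; congr (_ + _); apply: big1 => k _.
    by rewrite local_jump_eq0 ?mul0r // ltnS leq_addr.
  apply: (@squeeze_cvgr _ _ _ _ (fun=> 0) (fun n => `|y| ^+ n)); last 2 first.
  - exact: cvg_cst.
  - by apply: cvg_expr; rewrite normr_id.
  near=> n; have y0 : 0 <= y by rewrite invr_ge0.
  have /andP[h0 h1] := f_prime_power_bounds n pp.
  rewrite mulr_ge0 ?exprn_ge0 //= ger0_norm // exprSr mulrA.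
  rewrite -[leRHS]mulr1 ler_pM ?mulr_ge0 ?exprn_ge0 //.
    by rewrite ler_piMl ?exprn_ge0.
  by move: y1; rewrite ger0_norm // => /ltW.
by rewrite (cvg_lim _ cv) //; field.
Unshelve. all: by end_near. Qed.

Lemma G1_eq_sum_terms : G1 q f = \sum_(t <- terms) t.2 * t.1%:R^-1.
Proof.
rewrite (@euler_product _ _ _ _ id (fun d => d%:R^-1)) ?primes_uniq ?primes_prime //.
- apply: eq_big_seq => p; rewrite mem_primes => /andP[pp _].
  by rewrite G1_local //; apply: eq_bigr => k _; rewrite natrX exprVn.
- by rewrite invr1.
- by move=> m n _ _ _; rewrite natrM invfM.
Qed.

Definition fracpart (x : R) : R := x - (Num.truncn x)%:R.

Lemma fracpart_itv x : 0 <= x -> 0 <= fracpart x < 1.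
Proof.
by move=> /truncn_itv/andP[h1 h2]; rewrite /fracpart subr_ge0 h1 ltrBlDr addrC natr1.
Qed.

Lemma truncn_divn (x : R) d : 0 <= x -> (0 < d)%N ->
  Num.truncn (x / d%:R) = (Num.truncn x %/ d)%N.
Proof.
move=> x0 d0; apply: truncn_def.
have d0' : (0 : R) < d%:R by rewrite ltr0n.
have /andP[h1 h2] := truncn_itv x0.
rewrite ler_pdivlMr // ltr_pdivrMr // -!natrM; apply/andP; split.
  by apply: le_trans h1; rewrite ler_nat leq_trunc_div.
apply: lt_le_trans h2 _; rewrite ler_nat.
by rewrite {1}(divn_eq (Num.truncn x) d) mulSn -addnS addnC leq_add2r ltn_mod.
Qed.

(** Exchanging the sums leaves the difference of [floor (x / d)] and [floor x / d]; the main
    terms [x / d] cancel. *)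
Lemma sum_f_minus_G1 (x : R) : 0 <= x ->
  \sum_(1 <= n < (Num.truncn x).+1) (f n - G1 q f) =
  \sum_(t <- terms) t.2 * (fracpart x / t.1%:R - fracpart (x / t.1%:R)).
Proof.
move=> x0; set N := Num.truncn x.
rewrite sumrB sumr_const_nat subSS subn0 G1_eq_sum_terms -mulr_natr mulr_suml.
rewrite (eq_big_nat _ _ (F2 := fun n => \sum_(t <- terms) t.2 * (t.1 %| n)%:R)); last first.
  by move=> n /andP[n0 _]; exact: f_eq_sum_terms.
rewrite exchange_big /= -sumrB; apply: eq_big_seq => t /terms_gt0 t0.
rewrite -mulr_sumr -natr_sum -divn_count_dvd /fracpart truncn_divn // -/N.
by ring.
Qed.
End Expansion.
End DivisorExpansion.

(** * The Dirichlet polynomial of the Moebius transform *)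

Section DirichletPolynomial.
Context {R : realType}.
Implicit Types (sigma theta xi z : R) (n p : nat).

Definition rpow sigma n : R := expR (- (sigma * ln n%:R)).

(** The complex power [n ^ (- sigma + i theta)]. *)
Definition cpow sigma theta n : R[i] :=
  (rpow sigma n * cos (theta * ln n%:R) +i* (rpow sigma n * sin (theta * ln n%:R)))%C.

Lemma rpow1 sigma : rpow sigma 1 = 1.
Proof. by rewrite /rpow ln1 mulr0 oppr0 expR0. Qed.

Lemma rpow_ge0 sigma n : 0 <= rpow sigma n. Proof. exact: expR_ge0. Qed.

Lemma ln_natM m n : (0 < m)%N -> (0 < n)%N ->
  ln ((m * n)%N%:R : R) = ln m%:R + ln n%:R.
Proof. by move=> m0 n0; rewrite natrM lnM // posrE ltr0n. Qed.

Lemma rpowM sigma m n : (0 < m)%N -> (0 < n)%N ->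
  rpow sigma (m * n) = rpow sigma m * rpow sigma n.
Proof. by move=> m0 n0; rewrite /rpow ln_natM // -expRD; congr expR; ring. Qed.

Lemma cpow1 sigma theta : cpow sigma theta 1 = 1.
Proof. by rewrite /cpow rpow1 ln1 mulr0 cos0 sin0 mulr0 mulr1. Qed.

Lemma cpowM sigma theta m n : (0 < m)%N -> (0 < n)%N ->
  cpow sigma theta (m * n) = cpow sigma theta m * cpow sigma theta n.
Proof.
move=> m0 n0; rewrite /cpow ln_natM // rpowM // mulrDr cosD sinD.
by apply/eqP; rewrite eq_complex /=; apply/andP; split; apply/eqP; ring.
Qed.

Lemma cpowX sigma theta n k : (0 < n)%N -> cpow sigma theta (n ^ k) = cpow sigma theta n ^+ k.
Proof.
move=> n0; elim: k => [|k IH]; first by rewrite expn0 cpow1.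
by rewrite expnS cpowM ?expn_gt0 ?n0 // IH exprS.
Qed.

Lemma rpowX sigma n k : (0 < n)%N -> rpow sigma (n ^ k) = rpow sigma n ^+ k.
Proof.
move=> n0; elim: k => [|k IH]; first by rewrite expn0 rpow1.
by rewrite expnS rpowM ?expn_gt0 ?n0 // IH exprS.
Qed.

Lemma normc_polar (r y : R) : 0 <= r -> normc (r * cos y +i* (r * sin y))%C = r.
Proof.
by move=> r0; rewrite /normc /= !exprMn -mulrDr cos2Dsin2 mulr1 sqrtr_sqr ger0_norm.
Qed.

Lemma normc_cpow sigma theta n : normc (cpow sigma theta n) = rpow sigma n.
Proof. exact/normc_polar/rpow_ge0. Qed.

Lemma ln_ge0_nat n : 0 <= ln n%:R :> R.
Proof. by case: n => [|n]; [rewrite ln0 | rewrite ln_ge0 // ler1n]. Qed.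

Lemma rpow_le1 sigma n : 0 <= sigma -> rpow sigma n <= 1.
Proof.
by move=> s0; rewrite /rpow -[leRHS](@expR0 R) ler_expR oppr_le0 mulr_ge0 // ln_ge0_nat.
Qed.

(** Since [2 ^ 10 >= (5 / 4) ^ 31]. The exponent [10 / 31] is slightly smaller than [1 / 3], the
    least [1 - xi / ln z] in the theorem: this leaves room for moving [xi] by up to [1 / 2]. *)
Lemma rpow_le_4_5 sigma p : prime p -> 10 / 31 <= sigma -> rpow sigma p <= 4 / 5.
Proof.
move=> pp s.
have p2 : 2 <= p%:R :> R by rewrite ler_nat prime_gt1.
rewrite -(@ler_pXn2r _ 31) ?nnegrE ?rpow_ge0 // /rpow -expRM_natl.
apply: (@le_trans _ _ (expR (- (10%:R * ln 2)))).
  rewrite ler_expR mulrN lerN2 mulrA.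
  have l2 : 0 <= ln 2 :> R by rewrite ln_ge0 //; lra.
  have lp : ln 2 <= ln p%:R :> R by rewrite ler_ln ?posrE; lra.
  apply: (@le_trans _ _ (31 * sigma * ln 2)); first by rewrite ler_wpM2r //; lra.
  by rewrite ler_wpM2l //; lra.
rewrite expRN expRM_natl lnK ?posrE //.
lra.
Qed.

Lemma rpow_gt_third sigma p : prime p -> 1 / 3 <= sigma -> 1 / 3 < rpow sigma p ->
  p%:R <= 27 :> R.
Proof.
move=> pp s h; have p0 : (0 : R) < p%:R by rewrite ltr0n prime_gt0.
have : rpow sigma p ^+ 3 <= p%:R^-1.
  rewrite /rpow -expRM_natl -{2}[p%:R]lnK ?posrE // -expRN ler_expR.
  by rewrite mulrN lerN2 mulrA ler_peMl ?ln_ge0_nat //; lra.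
have : (1 / 3) ^+ 3 <= rpow sigma p ^+ 3 by rewrite lerXn2r ?nnegrE ?rpow_ge0 // ltW.
move=> h1 h2; have := ler_wpM2l (ltW p0) (le_trans h1 h2).
by rewrite mulfV ?gt_eqF //; lra.
Qed.

Section LocalBounds.
Variables (q : nat) (f : nat -> R).
Hypotheses (q0 : (0 < q)%N) (adm : admissible q f).

Lemma logn_primes p : p \in primes q -> exists a, logn p q = a.+1.
Proof.
by rewrite -logn_gt0; case: (logn p q) => // a _; exists a.
Qed.

Lemma local_f0 p : f (p ^ 0)%N = 1. Proof. by case: (adm) => -[]. Qed.

Lemma sum_norm_terms_le sigma : 10 / 31 <= sigma ->
  \sum_(t <- terms q f) `|t.2| * rpow sigma t.1 <=
  expR (\sum_(p <- primes q) (1 - f p) * rpow sigma p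
        + 5 * \sum_(p <- primes q) rpow sigma p ^+ 2).
Proof.
move=> s.
rewrite (@euler_product _ _ _ _ _ (fun x => `|x|) (rpow sigma))
  ?primes_uniq ?primes_prime ?rpow1 //; last 3 first.
- exact: normr1.
- exact: normrM.
- by move=> m n m0 n0 _; rewrite rpowM.
rewrite mulr_sumr -big_split /= expR_sum big_seq [leRHS]big_seq.
apply: ler_prod => p pq; apply/andP; split.
  by apply: sumr_ge0 => k _; rewrite mulr_ge0 ?rpow_ge0.
have [a ->] := logn_primes pq.
have pp : prime p by move: pq; rewrite mem_primes => /andP[].
have := @sum_norm_jump_le R (fun k => f (p ^ k)%N) (local_f0 p)
  (fun k => f_prime_power_bounds adm k pp) (rpow sigma p) a (rpow_ge0 _ _) (rpow_le_4_5 pp s).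
rewrite expn1; apply: le_trans; apply: ler_sum => k _.
by rewrite rpowX ?prime_gt0.
Qed.

Lemma sum_terms_itv sigma : 0 <= sigma ->
  0 <= \sum_(t <- terms q f) t.2 * rpow sigma t.1 <= 1.
Proof.
move=> s.
rewrite (@euler_product _ _ _ _ _ id (rpow sigma)) ?primes_uniq ?primes_prime ?rpow1 //; last first.
  by move=> m n m0 n0 _; rewrite rpowM.
suff H p : p \in primes q ->
    0 <= \sum_(k < (logn p q).+1) local_jump f p k * rpow sigma (p ^ k) <= 1.
  by rewrite big_seq prodr_ge0 ?prodr_ile1 // => p pq; have /andP[] := H p pq.
move=> pq; have pp : prime p by move: pq; rewrite mem_primes => /andP[].
have p01 : 0 <= rpow sigma p <= 1 by rewrite rpow_ge0 rpow_le1.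
have := @sum_jump_itv R (fun k => f (p ^ k)%N) (local_f0 p)
  (fun k => f_prime_power_bounds adm k pp) (rpow sigma p) (logn p q) p01.
under eq_bigr do rewrite -rpowX ?prime_gt0 //.
move=> /andP[h1 ->]; rewrite andbT; apply: le_trans h1.
by rewrite subr_ge0; case/andP: p01.
Qed.

Lemma G1_itv : 0 <= G1 q f <= 1.
Proof.
rewrite G1_eq_sum_terms //.
have := @sum_terms_itv 1 ler01.
rewrite (eq_big_seq (fun t => t.2 * t.1%:R^-1)) // => t /terms_gt0 t0.
by rewrite /rpow mul1r expRN lnK // posrE ltr0n.
Qed.

(** If [p ^ - sigma <= 1 / 3] any phase will do. Otherwise [p <= 27], and as [theta] is tiny
    the phase [theta * ln p] is close to [0]. *)
Lemma local_factor_ge sigma theta p : p \in primes q ->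
  1 / 3 <= sigma -> 0 <= theta <= 1 / (500 * 500) ->
  expR (- ((1 - f p) * (rpow sigma p * cos (theta * ln p%:R))) - 5 * rpow sigma p ^+ 2) <=
  normc (\sum_(k < (logn p q).+1) (local_jump f p k)%:C%C * cpow sigma theta (p ^ k)).
Proof.
move=> pq s /andP[th0 th1].
have [a aE] := logn_primes pq.
have pp : prime p by move: pq; rewrite mem_primes => /andP[].
have f01 k := f_prime_power_bounds adm k pp.
set w := cpow sigma theta p.
have nw : normc w = rpow sigma p by rewrite normc_cpow.
under eq_bigr do rewrite cpowX ?prime_gt0 // -/w.
rewrite -{1}(expn1 p) -nw.
rewrite {1}nw -[rpow _ _ * cos _]/(complex.Re w).
have [small|big] := leP (rpow sigma p) (1 / 3).
  rewrite aE; apply: (@normc_sum_jump_ge_small R (fun k => f (p ^ k)%N)) => //.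
    exact: local_f0.
  by rewrite nw.
have p27 := rpow_gt_third pp s big.
have lp : ln p%:R <= 27 :> R.
  by apply: le_trans p27; rewrite ltW // ln_sublinear // ltr0n prime_gt0.
set y := theta * ln p%:R.
have y0 : 0 <= y by rewrite mulr_ge0 // ln_ge0_nat.
have y1 : y <= 27 / (500 * 500).
  by rewrite /y; have := ln_ge0_nat p; nra.
have cy : 1 - y ^+ 2 / 2 <= cos y := cos_ge_quadratic y.
have t1 : rpow sigma p <= 4 / 5 by apply: rpow_le_4_5 => //; lra.
apply: (@normc_sum_jump_ge_near_real R (fun k => f (p ^ k)%N)) => //.
- exact: local_f0.
- by rewrite nw ltW.
- by rewrite /w /= mulr_ge0 ?rpow_ge0 // -/y; nra.
rewrite nw.
have -> : w - (rpow sigma p)%:C%C = (rpow sigma p)%:C%C * ((cos y - 1) +i* sin y)%C.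
  by apply/eqP; rewrite eq_complex /= -/y; apply/andP; split; apply/eqP; ring.
rewrite normcM normc_real ger0_norm ?rpow_ge0 //.
have ny : normc ((cos y - 1) +i* sin y)%C <= y.
  rewrite /normc /= -[leRHS]ger0_norm // -sqrtr_sqr ler_wsqrtr //.
  by have := cos2Dsin2 y; nra.
have := rpow_ge0 sigma p.
by nra.
Qed.

Lemma normc_sum_terms_ge sigma theta : 1 / 3 <= sigma -> 0 <= theta <= 1 / (500 * 500) ->
  expR (- (\sum_(p <- primes q) (1 - f p) * (rpow sigma p * cos (theta * ln p%:R)))
        - 5 * \sum_(p <- primes q) rpow sigma p ^+ 2) <=
  normc (\sum_(t <- terms q f) t.2%:C%C * cpow sigma theta t.1).
Proof.
move=> s th.
rewrite (@euler_product _ _ _ _ _ (real_complex R) (cpow sigma theta))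
  ?primes_uniq ?primes_prime ?cpow1 //; last 2 first.
- by move=> x y; rewrite rmorphM.
- by move=> m n m0 n0 _; rewrite cpowM.
have normc_prod (s' : seq nat) (F : nat -> R[i]) :
    normc (\prod_(p <- s') F p) = \prod_(p <- s') normc (F p).
  by elim/big_rec2: _ => [|i y x _ <-]; rewrite ?normc1 // normcM.
rewrite normc_prod mulr_sumr -sumrN -sumrB expR_sum big_seq [leRHS]big_seq.
apply: ler_prod => p pq; rewrite expR_ge0 /=; exact: local_factor_ge.
Qed.

Section Scale.
Variable z : R.
Hypothesis L1 : 10 ^+ 6 <= ln z.
Hypothesis qz : forall p : nat, prime p -> (p %| q)%N -> p%:R <= z.

Let L0 : 0 < ln z.
Proof. by move: L1; lra. Qed.
Let z0 : 0 < z.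
Proof. by rewrite ltNge; apply/negP => /ln0 h; move: L0; rewrite h ltxx. Qed.

Lemma rpowE xi p : prime p -> p%:R^-1 * p%:R `^ (xi / ln z) = rpow (1 - xi / ln z) p.
Proof.
move=> pp; have p0 : (0 : R) < p%:R by rewrite ltr0n prime_gt0.
rewrite /powR gt_eqF // -{1}[p%:R]lnK ?posrE // -expRN -expRD /rpow.
by congr expR; ring.
Qed.

Lemma H_rpow xi : H q f z xi = \sum_(p <- primes q) (1 - f p) * rpow (1 - xi / ln z) p.
Proof.
apply: eq_big_seq => p; rewrite mem_primes => /andP[pp _].
by rewrite expr0 mulr1 -mulrA rpowE.
Qed.

Lemma H2_rpow xi : Hj q f 2 z xi = \sum_(p <- primes q)
  (1 - f p) * rpow (1 - xi / ln z) p * (1 - ln p%:R / ln z) ^+ 2.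
Proof.
apply: eq_big_seq => p; rewrite mem_primes => /andP[pp _].
have p0 : (0 : R) < p%:R by rewrite ltr0n prime_gt0.
rewrite -[(1 - f p) / p%:R * _]mulrA rpowE //.
suff -> : ln (z / p%:R) / ln z = 1 - ln p%:R / ln z by [].
by rewrite ln_div ?posrE //; field; rewrite gt_eqF // L0.
Qed.

Lemma J_rpow xi : J q z xi = \sum_(p <- primes q) rpow (1 - xi / ln z) p ^+ 2.
Proof.
apply: eq_big_seq => p; rewrite mem_primes => /andP[pp _].
rewrite -rpowE // exprMn exprVn; congr (_ * _).
by rewrite -powR_mulrn ?powR_ge0 // -powRrM; congr (_ `^ _); ring.
Qed.

Lemma f_le1 p : p \in primes q -> 0 <= f p <= 1.
Proof.
by rewrite mem_primes => /andP[pp _]; have := f_prime_power_bounds adm 1 pp; rewrite expn1.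
Qed.

Lemma ratio_itv p : p \in primes q -> 0 <= ln p%:R / ln z <= 1.
Proof.
rewrite mem_primes => /and3P[pp _ pdq].
rewrite divr_ge0 ?ln_ge0_nat ?(ltW L0) //= ler_pdivrMr ?L0 // mul1r.
by rewrite ler_ln ?posrE ?ltr0n ?prime_gt0 // qz.
Qed.

Lemma sum_norm_terms_le_H xi : 10 / 31 <= 1 - xi / ln z ->
  \sum_(t <- terms q f) `|t.2| * rpow (1 - xi / ln z) t.1 <=
  expR (H q f z xi + 5 * J q z xi).
Proof. by move=> ?; rewrite H_rpow J_rpow sum_norm_terms_le. Qed.

(** With frequency [pi / ln z] the primes near [z] get the phase [-1], which turns
    the factor [exp (- (1 - f p) p^-s)] from small into large; [H2] measures how far
    the phases are from [-1]. *)
Lemma normc_sum_terms_ge_H xi : xi <= 2 / 3 * ln z ->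
  expR (H q f z xi - 5 * Hj q f 2 z xi - 5 * J q z xi) <=
  normc (\sum_(t <- terms q f) t.2%:C%C * cpow (1 - xi / ln z) (pi / ln z) t.1).
Proof.
move=> xi2.
have s : 1 / 3 <= 1 - xi / ln z.
  by rewrite lerBrDr -lerBrDl ler_pdivrMr ?L0 //; lra.
have th : 0 <= pi / ln z <= 1 / (500 * 500).
  rewrite divr_ge0 ?pi_ge0 ?(ltW L0) //= ler_pdivrMr ?L0 //.
  have := @pihalf_lt2 R; rewrite ltr_pdivrMr // => h.
  by apply: le_trans (ltW h) _; move: (ln z) L1 => l hl; lra.
apply: le_trans (normc_sum_terms_ge s th).
rewrite ler_expR J_rpow lerD2r H_rpow H2_rpow mulr_sumr -sumrB -sumrN.
rewrite big_seq [leRHS]big_seq; apply: ler_sum => p pq.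
have /andP[f0 f1] := f_le1 pq.
set t := rpow _ _; set y := ln p%:R / ln z.
have t0 : 0 <= t by exact: rpow_ge0.
have -> : pi / ln z * ln p%:R = pi - pi * (1 - y) by rewrite /y; ring.
rewrite cosB cospi sinpi mul0r addr0 mulN1r.
have h := cos_pi_ge (1 - y).
have ft : 0 <= (1 - f p) * t by rewrite mulr_ge0 // subr_ge0.
have -> : (1 - f p) * t - 5 * ((1 - f p) * t * (1 - y) ^+ 2) =
  (1 - f p) * t * (1 - 5 * (1 - y) ^+ 2) by ring.
have -> : - ((1 - f p) * (t * - cos (pi * (1 - y)))) = (1 - f p) * t * cos (pi * (1 - y)) by ring.
exact: ler_wpM2l.
Qed.
End Scale.
End LocalBounds.
End DirichletPolynomial.

(** * The discrepancy as a combination of translates *)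

Section Discrepancy.
Context {R : realType}.
Implicit Types (u xi z : R).

(** With [x = expR (l * u)] and [s = 1 - xi / l], this is [{x} * x ^ - s]. *)
Definition sawtooth (l xi u : R) : R := fracpart (expR (l * u)) * expR (- ((l - xi) * u)).

(** With [x] and [s] as above, [tent xi (l - xi) u] is [min x 1 * x ^ - s]. *)
Definition tent (A B u : R) : R := Num.min (expR (A * u)) (expR (- (B * u))).

Lemma tent_ge0 A B u : 0 <= tent A B u.
Proof. by rewrite /tent le_min !expR_ge0. Qed.

Lemma tent_le1 A B u : 0 <= A -> 0 <= B -> tent A B u <= 1.
Proof.
move=> A0 B0; rewrite /tent ge_min -(@expR0 R) !ler_expR oppr_le0.
have [u0|u0] := leP u 0; first by rewrite mulr_ge0_le0.
by rewrite [X in _ || X]mulr_ge0 ?orbT // ltW.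
Qed.

Lemma fracpart_le (x : R) : 0 <= x -> fracpart x <= x.
Proof. by move=> x0; rewrite /fracpart lerBlDr lerDl. Qed.

Lemma sawtooth_itv l xi u : 0 <= sawtooth l xi u <= tent xi (l - xi) u.
Proof.
have /andP[f0 f1] := fracpart_itv (expR_ge0 (l * u)).
have f2 := fracpart_le (expR_ge0 (l * u)).
rewrite /sawtooth mulr_ge0 ?expR_ge0 //= /tent le_min; apply/andP; split.
  apply: le_trans (ler_wpM2r (expR_ge0 _) f2) _.
  by rewrite -expRD ler_expR le_eqVlt; apply/orP; left; apply/eqP; ring.
by rewrite ler_piMl ?expR_ge0 // ltW.
Qed.

Section Fixed.
Variables (q : nat) (f : nat -> R) (z : R).
Hypotheses (q0 : (0 < q)%N) (adm : admissible q f) (L0 : 0 < ln z).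
Local Notation L := (ln z).
Local Notation lambda t := (ln t.1%:R / ln z).
Local Notation x_ u := (expR (ln z * u)).

Definition discrepancy u : R := expR (- (L * u)) *
  \sum_(t <- terms q f) t.2 * (fracpart (x_ u) / t.1%:R - fracpart (x_ u / t.1%:R)).

Lemma E_discrepancy u : E q f z u = discrepancy u.
Proof.
have z0 : 0 < z by rewrite ltNge; apply/negP => /ln0 h; move: L0; rewrite h ltxx.
have zu : z `^ u = x_ u by rewrite /powR gt_eqF // mulrC.
by rewrite /E zu sum_f_minus_G1 ?expR_ge0 // /discrepancy expRN.
Qed.

Lemma x_div u d : (0 < d)%N -> x_ u / d%:R = expR (L * (u - ln d%:R / L)).
Proof.
move=> d0; have d0' : (0 : R) < d%:R by rewrite ltr0n.
have -> : L * (u - ln d%:R / L) = L * u + - ln d%:R by field; rewrite gt_eqF.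
by rewrite expRD expRN lnK ?posrE.
Qed.

(** As [x / d = expR (ln z * (u - ln d / ln z))], all divisors contribute translates of the
    same function. *)
Lemma weighted_discrepancy xi u : expR (xi * u) * discrepancy u =
  - \sum_(t <- terms q f) t.2 * (rpow (1 - xi / L) t.1 * sawtooth L xi (u - lambda t)
                                - t.1%:R^-1 * sawtooth L xi u).
Proof.
rewrite /discrepancy mulrA mulr_sumr -sumrN; apply: eq_big_seq => t /terms_gt0 t0.
rewrite x_div // /sawtooth.
have -> : rpow (1 - xi / L) t.1 * (fracpart (expR (L * (u - lambda t))) *
    expR (- ((L - xi) * (u - lambda t)))) =
    expR (xi * u) * expR (- (L * u)) * fracpart (expR (L * (u - lambda t))).
  rewrite mulrCA /rpow -!expRD mulrC; congr (_ * _); congr expR; field.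
  by rewrite gt_eqF.
have -> : expR (- ((L - xi) * u)) = expR (xi * u) * expR (- (L * u)).
  by rewrite -expRD; congr expR; ring.
by ring.
Qed.

(** Both [{x} / d] and [{x / d}] lie between [0] and [min 1 (x / d)]. *)
Lemma norm_weighted_discrepancy_le xi u :
  `|expR (xi * u) * discrepancy u| <=
  \sum_(t <- terms q f) `|t.2| * rpow (1 - xi / L) t.1 * tent xi (L - xi) (u - lambda t).
Proof.
rewrite /discrepancy mulrA mulr_sumr; apply: le_trans (ler_norm_sum _ _ _) _.
rewrite big_seq [leRHS]big_seq; apply: ler_sum => t /terms_gt0 t0.
have d0 : (0 : R) < t.1%:R by rewrite ltr0n.
have d1 : (1 : R) <= t.1%:R by rewrite ler1n.
rewrite normrM -expRD ger0_norm ?expR_ge0 // normrM mulrCA -[leRHS]mulrA ler_wpM2l //.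
set D := `|_ - _|; set x := x_ u.
have x0 : 0 <= x by exact: expR_ge0.
have xd0 : 0 <= x / t.1%:R by rewrite divr_ge0 // ltW.
have /andP[a0 a1] := fracpart_itv x0; have a2 := fracpart_le x0.
have /andP[b0 b1] := fracpart_itv xd0; have b2 := fracpart_le xd0.
have c0 : 0 <= fracpart x / t.1%:R by rewrite divr_ge0 // ltW.
have c1 : fracpart x / t.1%:R <= 1 by rewrite ler_pdivrMr // mul1r (le_trans (ltW a1)).
have c2 : fracpart x / t.1%:R <= x / t.1%:R by rewrite ler_pM2r ?invr_gt0.
have D1 : D <= 1 by rewrite /D ler_norml; apply/andP; split; rewrite -/x; lra.
have D2 : D <= x / t.1%:R by rewrite /D ler_norml; apply/andP; split; rewrite -/x; lra.
rewrite /tent minr_pMr ?rpow_ge0 // le_min; apply/andP; split.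
  apply: le_trans (ler_wpM2l (expR_ge0 _) D2) _.
  rewrite x_div // /rpow -!expRD ler_expR le_eqVlt; apply/orP; left; apply/eqP; field.
  by rewrite gt_eqF.
apply: le_trans (ler_wpM2l (expR_ge0 _) D1) _.
rewrite mulr1 /rpow -!expRD ler_expR le_eqVlt; apply/orP; left; apply/eqP; field.
by rewrite gt_eqF.
Qed.

End Fixed.

Lemma discrepancy_upper_bound (q : nat) (f : nat -> R) z xi u :
  (0 < q)%N -> admissible q f -> 10 ^+ 6 <= ln z ->
  0 <= xi -> xi <= 2 / 3 * ln z ->
  `|E q f z u| <= expR (H q f z xi - xi * u + 5 * J q z xi).
Proof.
move=> q0 adm L1 xi0 xi2.
have L0 : 0 < ln z by move: L1; lra.
have xiL : 10 / 31 <= 1 - xi / ln z.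
  by rewrite lerBrDr -lerBrDl ler_pdivrMr // {L1}; lra.
rewrite E_discrepancy //.
have -> : H q f z xi - xi * u + 5 * J q z xi = H q f z xi + 5 * J q z xi - xi * u by ring.
rewrite expRB ler_pdivlMr ?expR_gt0 // mulrC -[X in X * _]gtr0_norm ?expR_gt0 // -normrM.
apply: le_trans; first exact: norm_weighted_discrepancy_le.
apply: le_trans (sum_norm_terms_le_H adm xiL).
apply: ler_sum => t _; rewrite ler_piMr ?mulr_ge0 ?rpow_ge0 // tent_le1 //.
by move: L1; lra.
Qed.
End Discrepancy.

(** * Translation-invariant integration on the real line *)

Section LineIntegral.
Context {R : realType}.
Local Notation mu := (@lebesgue_measure R).
Implicit Types (a A B : R) (F G : R -> R).

Definition integrableR F := mu.-integrable [set: R] (EFin \o F).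
Definition line_integral F : R := (\int[mu]_x F x)%R.

(** Translation by [a], typed between the measurable spaces of reals so that it can carry the
    structure of measurable function that [pushforward] needs. *)
Definition translate a : measurableTypeR R -> measurableTypeR R := fun x => x + a.

Lemma measurable_translate a : measurable_fun [set: R] (translate a).
Proof. by apply: measurable_funD => //; exact: measurable_cst. Qed.

HB.instance Definition _ a := @isMeasurableFun.Build _ _ _ _ (translate a) (measurable_translate a).

Lemma lebesgue_measure_translate a (X : set R) : measurable X ->
  pushforward mu (translate a) X = mu X.
Proof.
move=> mX; apply/esym/lebesgue_measure_unique => //= _ [[b c]] _ <-.
rewrite /pushforward.
have -> : translate a @^-1` `](b, c).1, (b, c).2]%classic = `]b - a, c - a]%classic.
  by apply/seteqP; split=> x; rewrite /translate /= !in_itv /= ltrBlDr lerBrDr.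
rewrite !lebesgue_measure_itv /= !lte_fin ltrD2r.
by case: ifP => // _; rewrite -!EFinB; congr (_%:E); ring.
Qed.

Lemma integrable_shift a F : integrableR F -> integrableR (fun x => F (x + a)).
Proof.
move=> /integrableP[mF iF]; apply/integrableP; split.
  apply/measurable_EFinP; apply: (measurableT_comp (f := F)); last exact: measurable_translate.
  by apply/measurable_EFinP.
have -> : (\int[mu]_x `|(EFin \o (fun x => F (x + a)%R)) x|)%E = (\int[mu]_x `|(EFin \o F) x|)%E.
  rewrite -[RHS](@eq_measure_integral _ _ _ _ _ (pushforward mu (translate a))); last first.
    by move=> X mX _; apply: lebesgue_measure_translate.
  rewrite ge0_integral_pushforward //.
  exact: measurableT_comp.
exact: iF.
Qed.

Lemma line_integral_shift a F : integrableR F ->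
  line_integral (fun x => F (x + a)) = line_integral F.
Proof.
move=> iF; rewrite /line_integral /Rintegral; congr fine.
rewrite -[RHS](@eq_measure_integral _ _ _ _ _ (pushforward mu (translate a))); last first.
  by move=> X mX _; apply: lebesgue_measure_translate.
rewrite integral_pushforward //.
- by case/integrableP: iF.
- exact: (integrable_shift a iF).
Qed.

Lemma line_integral_sum (I : eqType) (s : seq I) (F : I -> R -> R) :
  (forall i, i \in s -> integrableR (F i)) ->
  integrableR (fun x => \sum_(i <- s) F i x) /\
  line_integral (fun x => \sum_(i <- s) F i x) = \sum_(i <- s) line_integral (F i).
Proof.
elim: s => [|i s IH] iF.
  split.
    rewrite /integrableR (_ : _ \o _ = cst 0%E); first exact: integrable0.
    by apply/funext => x /=; rewrite big_nil.
  rewrite big_nil /line_integral /Rintegral.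
  by under eq_integral do rewrite big_nil; rewrite integral0.
have [j jE] := IH (fun k ks => iF k (mem_behead (s := i :: s) ks)).
have ii := iF i (mem_head i s).
have E : (fun x => \sum_(i0 <- i :: s) F i0 x) = (fun x => F i x + \sum_(j <- s) F j x).
  by apply/funext => x; rewrite big_cons.
rewrite E big_cons -jE; split; last by rewrite /line_integral RintegralD.
exact: (integrableD _ ii j).
Qed.

Lemma line_integralZ k F : integrableR F ->
  integrableR (fun x => k * F x) /\ line_integral (fun x => k * F x) = k * line_integral F.
Proof.
move=> iF; split; last by rewrite /line_integral RintegralZl.
exact: (integrableZl _ k iF).
Qed.

Lemma line_integralD F G : integrableR F -> integrableR G ->
  integrableR (fun x => F x + G x) /\
  line_integral (fun x => F x + G x) = line_integral F + line_integral G.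
Proof.
move=> iF iG; split; last by rewrite /line_integral RintegralD.
exact: (integrableD _ iF iG).
Qed.

Lemma le_line_integral F G : integrableR F -> integrableR G ->
  (forall x, F x <= G x) -> line_integral F <= line_integral G.
Proof. by move=> iF iG FG; apply: le_Rintegral. Qed.

Lemma integrableR_le F G : measurable_fun [set: R] F -> integrableR G ->
  (forall x, `|F x| <= G x) -> integrableR F.
Proof.
move=> mF iG FG; apply: le_integrable iG => //; first exact/measurable_EFinP.
by move=> x _ /=; rewrite lee_fin (le_trans (FG x)) // ler_norm.
Qed.

Lemma line_integral_indic (a b : R) : a <= b ->
  integrableR (\1_(`[a, b]) : R -> R) /\ line_integral (\1_(`[a, b])) = b - a.
Proof.
move=> ab; split; first exact: integrable_indic_itv.
rewrite /line_integral /Rintegral integral_indic //= setIT lebesgue_measure_itv /= lte_fin.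
case: ltP ab => [//|ba ab]; have -> : a = b by apply/le_anti/andP.
by rewrite subrr.
Qed.

End LineIntegral.

(** * The tent and the sawtooth *)

Section RayIntegral.
Context {R : realType}.
Local Notation mu := (@lebesgue_measure R).
Implicit Types (a b A B C : R) (F f : R -> R).

Lemma ge0_integral_line f : measurable_fun [set: R] f -> (forall x, 0 <= f x) ->
  (\int[mu]_x (f x)%:E = \int[mu]_(x in `]0%R, +oo[) (f (- x))%:E
                         + \int[mu]_(x in `]0%R, +oo[) (f x)%:E)%E.
Proof.
move=> mf f0.
have mfE : measurable_fun [set: R] (EFin \o f) by exact/measurable_EFinP.
have mfN : measurable_fun [set: R] (EFin \o (fun x => f (- x))).
  apply/measurable_EFinP; apply: (measurableT_comp (f := f)) => //.
rewrite [X in (_ = X + _)%E]integral_itv_obnd_cbnd; last exact: measurable_funS mfN.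
rewrite (@ge0_integration_by_substitution0 _ (EFin \o (fun x => f (- x)))) //=; last first.
  by move=> r; rewrite lee_fin.
under [X in (_ = X + _)%E]eq_integral do rewrite /= opprK.
rewrite -(setUv `]-oo, 0%R]%classic) ge0_integral_setU //=; last 4 first.
- exact: measurableC.
- exact: measurable_funS mfE.
- by move=> x _; rewrite lee_fin.
- exact/disj_setPCl.
by rewrite setCitvl.
Qed.

Lemma cvg_expRNM a : 0 < a -> expR (- (a * x)) @[x --> +oo] --> (0 : R).
Proof.
move=> a0; apply: (@cvg_comp _ _ _ (fun x => a * x) (fun y => expR (- y)) _ (pinfty_nbhs R)).
  exact: gt0_cvgMry.
exact: cvgr_expR.
Qed.

(** The antiderivative [F] vanishes at infinity. *)
Lemma ge0_integral_ray a C f F : 0 < a -> (forall x, 0 <= f x) -> continuous f ->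
  (forall x : R, is_derive x 1 F (f x)) -> (forall x, `|F x| <= C * expR (- (a * x))) ->
  (\int[mu]_(x in `]0%R, +oo[) (f x)%:E = (- F 0)%:E)%E.
Proof.
move=> a0 f0 cf dF Fle.
rewrite integral_itv_obnd_cbnd; last first.
  by apply/measurable_EFinP/measurable_funTS; exact: continuous_measurable_fun.
rewrite (@ge0_continuous_FTC2y _ f F 0 0) ?sub0e ?EFinN //.
- exact: continuous_subspaceT.
- apply: norm_cvg0; apply: (@squeeze_cvgr _ _ _ _ (fun=> 0) (fun x => C * expR (- (a * x)))).
  + by apply: nearW => x; rewrite normr_ge0 Fle.
  + exact: cvg_cst.
  + by rewrite -(mulr0 C); apply: cvgMl_tmp; exact: cvg_expRNM.
- apply: cvg_at_right_filter; apply: differentiable_continuous.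
  by apply/derivable1_diffP; case: (dF 0).
- by move=> x _; have dFx := dF x; rewrite derive1E derive_val.
Qed.

Lemma integral_exp_ray a : 0 < a ->
  (\int[mu]_(x in `]0%R, +oo[) (expR (- (a * x)))%:E = (a^-1)%:E)%E.
Proof.
move=> a0.
apply: etrans; first apply: (@ge0_integral_ray a a^-1 _ (fun x => - (expR (- (a * x)) / a))) => //.
- move=> x; apply: differentiable_continuous; apply/derivable1_diffP; exact: ex_derive.
- move=> x; apply: is_derive_eq; rewrite /GRing.scale /=; field.
  by rewrite gt_eqF.
- by move=> x; rewrite normrN ger0_norm ?divr_ge0 ?expR_ge0 ?(ltW a0) // mulrC.
- by rewrite /= mulr0 oppr0 expR0 opprK div1r.
Qed.

(** Adding [1] to the cosine makes the integrand nonnegative, so that the improper integral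
    can be evaluated from an antiderivative. *)
Lemma integral_expcos_ray a b : 0 < a ->
  (\int[mu]_(x in `]0%R, +oo[) (expR (- (a * x)) * (1 + cos (b * x)))%:E =
   (a^-1 + a / (a ^+ 2 + b ^+ 2))%:E)%E.
Proof.
move=> a0; set D := a ^+ 2 + b ^+ 2.
have D0 : 0 < D by rewrite /D ltr_pwDl ?exprn_gt0 ?sqr_ge0.
apply: etrans; first apply: (@ge0_integral_ray a (a^-1 + (`|b| + a) / D) _
  (fun x => expR (- (a * x)) * ((b * sin (b * x) - a * cos (b * x)) / D - a^-1))) => //.
- move=> x; apply: differentiable_continuous; apply/derivable1_diffP; exact: ex_derive.
- move=> x; apply: is_derive_eq; rewrite /GRing.scale /=.
  rewrite /D; field.
  by rewrite -/D !gt_eqF.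
- move=> x; rewrite normrM ger0_norm ?expR_ge0 // mulrC ler_wpM2r ?expR_ge0 //.
  apply: le_trans (ler_normB _ _) _; rewrite addrC [`|a^-1|]ger0_norm ?invr_ge0 ?(ltW a0) //.
  rewrite lerD2l normrM [`|D^-1|]ger0_norm ?invr_ge0 ?(ltW D0) // ler_wpM2r ?invr_ge0 ?(ltW D0) //.
  apply: le_trans (ler_normB _ _) _; rewrite !normrM [`|a|]ger0_norm ?(ltW a0) //.
  by rewrite lerD // ler_piMr ?(ltW a0) // ?sin_max ?cos_max.
- rewrite /= !mulr0 oppr0 expR0 sin0 cos0; congr (_%:E); field.
  by rewrite !gt_eqF.
Qed.

Lemma ge0_line_integral f (i1 i2 : R) : measurable_fun [set: R] f -> (forall x, 0 <= f x) ->
  (\int[mu]_(x in `]0%R, +oo[) (f (- x))%:E = i1%:E)%E ->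
  (\int[mu]_(x in `]0%R, +oo[) (f x)%:E = i2%:E)%E ->
  integrableR f /\ line_integral f = i1 + i2.
Proof.
move=> mf f0 e1 e2.
have E : (\int[mu]_x (f x)%:E = (i1 + i2)%:E)%E.
  by rewrite (ge0_integral_line mf f0) e1 e2 EFinD.
split; last by rewrite /line_integral /Rintegral E.
apply/integrableP; split; first exact/measurable_EFinP.
under eq_integral do rewrite /= ger0_norm //.
by rewrite E ltry.
Qed.

Lemma measurable_expRM a : measurable_fun [set: R] (fun x => expR (a * x)).
Proof.
apply: (measurableT_comp (f := expR)); first exact: measurable_expR.
exact: mulrl_measurable.
Qed.

Lemma line_integral_tent A B : 0 < A -> 0 < B ->
  integrableR (tent A B) /\ line_integral (tent A B) = A^-1 + B^-1.
Proof.
move=> A0 B0; apply: ge0_line_integral.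
- apply: measurable_minr; first exact: measurable_expRM.
  by under eq_fun do rewrite -mulNr; exact: measurable_expRM.
- by move=> x; exact: tent_ge0.
- rewrite -integral_exp_ray //; apply: eq_integral => x.
  rewrite inE /= in_itv /= andbT => x0; rewrite /tent min_l ?mulrN // ler_expR.
  by rewrite opprK; nra.
- rewrite -integral_exp_ray //; apply: eq_integral => x.
  rewrite inE /= in_itv /= andbT => x0; rewrite /tent min_r // ler_expR.
  by nra.
Qed.

Section Sawtooth.
Variables l xi : R.
Hypotheses (l0 : 0 < l) (xi0 : 0 < xi) (xil : xi < l).

Lemma measurable_sawtooth : measurable_fun [set: R] (sawtooth l xi).
Proof.
apply: measurable_funM; last first.
  by under eq_fun do rewrite -mulNr; exact: measurable_expRM.
apply: measurable_funB; first exact: measurable_expRM.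
apply: nondecreasing_measurable => // x y xy.
by rewrite ler_nat le_truncn // ler_expR ler_pM2l.
Qed.

Lemma integrable_sawtoothM (k : R -> R) : measurable_fun [set: R] k ->
  (forall x, `|k x| <= 1) -> integrableR (fun u => sawtooth l xi u * k u).
Proof.
move=> mk k1; apply: (@integrableR_le _ _ (tent xi (l - xi))).
- exact: (measurable_funM measurable_sawtooth mk).
- by have [] := @line_integral_tent xi (l - xi) xi0; rewrite ?subr_gt0.
- move=> x; have /andP[s0 s1] := sawtooth_itv l xi x.
  by rewrite normrM (ger0_norm s0); apply: le_trans s1; rewrite ler_piMr.
Qed.

Lemma measurable_cosM b : measurable_fun [set: R] (fun u => cos (b * u)).
Proof.
apply: continuous_measurable_fun => x; apply: differentiable_continuous.
by apply/derivable1_diffP; exact: ex_derive.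
Qed.

Lemma measurable_sinM b : measurable_fun [set: R] (fun u => sin (b * u)).
Proof.
apply: continuous_measurable_fun => x; apply: differentiable_continuous.
by apply/derivable1_diffP; exact: ex_derive.
Qed.

Definition cos_moment := line_integral (fun u => sawtooth l xi u * cos (pi * u)).
Definition sin_moment := line_integral (fun u => sawtooth l xi u * sin (pi * u)).

Lemma integrable_sawtooth_cos : integrableR (fun u => sawtooth l xi u * cos (pi * u)).
Proof. by apply: integrable_sawtoothM; [exact: measurable_cosM | move=> x; exact: cos_max]. Qed.

Lemma integrable_sawtooth_sin : integrableR (fun u => sawtooth l xi u * sin (pi * u)).
Proof. by apply: integrable_sawtoothM; [exact: measurable_sinM | move=> x; exact: sin_max]. Qed.

Lemma integrable_sawtooth : integrableR (sawtooth l xi).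
Proof.
have := @integrable_sawtoothM (fun=> 1) (@measurable_cst _ _ _ _ _ _).
rewrite (_ : (fun u => _ * 1) = sawtooth l xi); last by apply/funext => u; rewrite mulr1.
by apply => x; rewrite normr1.
Qed.

Lemma line_integral_sawtooth_itv :
  0 <= line_integral (sawtooth l xi) <= xi^-1 + (l - xi)^-1.
Proof.
have [it itE] := @line_integral_tent xi (l - xi) xi0 ltac:(by rewrite subr_gt0).
have s u : 0 <= sawtooth l xi u <= tent xi (l - xi) u by exact: sawtooth_itv.
rewrite -itE le_line_integral ?andbT //; last first.
- by move=> x; case/andP: (s x).
- exact: integrable_sawtooth.
by apply: Rintegral_ge0 => x _; case/andP: (s x).
Qed.

(** For [u < 0] the sawtooth equals [expR (xi * u)], and this half-line contributes
    [xi / (xi ^+ 2 + pi ^+ 2)]. For [0 <= u <= 1 / 2] the integrand is nonnegative, and beyond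
    [1 / 2] it is exponentially small. *)
Lemma cos_moment_ge :
  xi / (xi ^+ 2 + pi ^+ 2) - expR (- ((l - xi) / 4)) * (2 / (l - xi)) <= cos_moment.
Proof.
have lx0 : 0 < l - xi by rewrite subr_gt0.
set B := l - xi in lx0 *.
(* [G1 - G2] is a lower bound for the integrand, written as a difference of nonnegative
   functions; for [u >= 1 / 2] one has [(l - xi) * u >= B / 4 + B / 2 * u]. *)
pose G1 (u : R) : R := if u < 0 then expR (xi * u) * (1 + cos (pi * u)) else 0.
pose G2 (u : R) : R := if u < 0 then expR (xi * u)
                       else expR (- (B / 4)) * expR (- (B / 2 * u)).
have mlt : measurable_fun [set: R] (fun u : R => u < 0) by exact: measurable_fun_ltr.
have m1 : measurable_fun [set: R] G1.
  apply: measurable_fun_ifT => //.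
  apply: measurable_funM; first exact: measurable_expRM.
  by apply: measurable_funD => //; exact: measurable_cosM.
have m2 : measurable_fun [set: R] G2.
  apply: measurable_fun_ifT => //; first exact: measurable_expRM.
  apply: measurable_funM => //.
  by under eq_fun do rewrite -mulNr; exact: measurable_expRM.
have [i1 e1] : integrableR G1 /\ line_integral G1 = xi^-1 + xi / (xi ^+ 2 + pi ^+ 2) + 0.
  apply: ge0_line_integral => //.
  - move=> u; rewrite /G1; case: ifP => // _; rewrite mulr_ge0 ?expR_ge0.
  - rewrite -integral_expcos_ray //; apply: eq_integral => x.
    rewrite inE /= in_itv /= andbT => x0; rewrite /G1 oppr_lt0 x0 !mulrN cosN //.
  - rewrite -[RHS](@integral0 _ _ _ mu `]0%R, +oo[); apply: eq_integral => x.
    by rewrite inE /= in_itv /= andbT => x0; rewrite /G1 ltNge (ltW x0).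
have [i2 e2] : integrableR G2 /\ line_integral G2 = xi^-1 + expR (- (B / 4)) * (2 / B).
  apply: ge0_line_integral => //.
  - by move=> u; rewrite /G2; case: ifP => // _; rewrite ?mulr_ge0 ?expR_ge0.
  - rewrite -integral_exp_ray //; apply: eq_integral => x.
    by rewrite inE /= in_itv /= andbT => x0; rewrite /G2 oppr_lt0 x0 mulrN.
  - rewrite -[2 / B]invf_div EFinM -integral_exp_ray ?divr_gt0 //.
    rewrite -ge0_integralZl //=; last first.
      apply/measurable_EFinP/measurable_funTS.
      by under eq_fun do rewrite -mulNr; exact: measurable_expRM.
    apply: eq_integral => x.
    by rewrite inE /= in_itv /= andbT => x0; rewrite /G2 ltNge (ltW x0).
have [iN eN] := line_integralZ (-1) i2.
have [iS eS] := line_integralD i1 iN.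
have : line_integral (fun x => G1 x + -1 * G2 x) <= cos_moment; last first.
  rewrite eS eN e1 e2; apply: le_trans; rewrite le_eqVlt; apply/orP; left; apply/eqP; ring.
apply: le_line_integral => //; first exact: integrable_sawtooth_cos.
move=> u; rewrite mulN1r /G1 /G2; case: ifP => [u0|/negbT].
  have -> : sawtooth l xi u = expR (xi * u).
    rewrite /sawtooth /fracpart (_ : Num.truncn _ = 0%N) ?subr0.
      by rewrite -expRD; congr expR; ring.
    apply: truncn_def; rewrite expR_ge0 /= expR_lt1.
    by rewrite pmulr_rlt0.
  by rewrite le_eqVlt; apply/orP; left; apply/eqP; ring.
rewrite -leNgt => u0; rewrite sub0r.
have /andP[s0 s1] := sawtooth_itv l xi u.
have [u2|u2] := leP u (1 / 2).
  apply: (@le_trans _ _ 0); first by rewrite oppr_le0 mulr_ge0 ?expR_ge0.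
  rewrite mulr_ge0 // cos_ge0_pihalf //.
  have p0 := @pi_gt0 R.
  by apply/andP; split; nra.
apply: (@le_trans _ _ (- sawtooth l xi u)); last first.
  by rewrite -mulrN1 ler_wpM2l // cos_geN1.
rewrite lerN2 (le_trans s1) // /tent ge_min -expRD [X in _ || X]ler_expR.
by apply/orP; right; rewrite -/B; nra.
Qed.
End Sawtooth.
End RayIntegral.

(** * Fourier transform of the discrepancy *)

Section Moments.
Context {R : realType}.
Implicit Types (u xi z : R).

Lemma line_integral_lin3 (F1 F2 F3 : R -> R) (a b c : R) :
  integrableR F1 -> integrableR F2 -> integrableR F3 ->
  integrableR (fun u => a * F1 u + b * F2 u + c * F3 u) /\
  line_integral (fun u => a * F1 u + b * F2 u + c * F3 u) =
  a * line_integral F1 + b * line_integral F2 + c * line_integral F3.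
Proof.
move=> i1 i2 i3.
have [j1 e1] := line_integralZ a i1; have [j2 e2] := line_integralZ b i2.
have [j3 e3] := line_integralZ c i3; have [j12 e12] := line_integralD j1 j2.
have [j e] := line_integralD j12 j3.
by split=> //; rewrite e e12 e1 e2 e3.
Qed.

Section Fixed.
Variables (q : nat) (f : nat -> R) (z xi : R).
Hypotheses (q0 : (0 < q)%N) (adm : admissible q f) (L0 : 0 < ln z).
Hypotheses (xi0 : 0 < xi) (xiL : xi < ln z).
Local Notation L := (ln z).
Local Notation lambda t := (ln t.1%:R / ln z).
Local Notation K := (sawtooth L xi).
Local Notation W u := (expR (xi * u) * discrepancy q f z u).
Local Notation C_ := (cos_moment L xi).
Local Notation S_ := (sin_moment L xi).
Local Notation G := (\sum_(t <- terms q f) t.2%:C%C * cpow (1 - xi / L) (pi / L) t.1).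

Lemma Re_sum (s : seq (nat * R)) (F : nat * R -> R[i]) :
  complex.Re (\sum_(t <- s) F t) = \sum_(t <- s) complex.Re (F t).
Proof. by elim/big_rec2: _ => [//|t x y _ <-]; case: (F t) => ? ?; case: y. Qed.

Lemma Im_sum (s : seq (nat * R)) (F : nat * R -> R[i]) :
  complex.Im (\sum_(t <- s) F t) = \sum_(t <- s) complex.Im (F t).
Proof. by elim/big_rec2: _ => [//|t x y _ <-]; case: (F t) => ? ?; case: y. Qed.

(** All translates of the sawtooth have the same integral. *)
Lemma mean_discrepancy :
  integrableR (fun u => W u) /\
  line_integral (fun u => W u) =
  (G1 q f - \sum_(t <- terms q f) t.2 * rpow (1 - xi / L) t.1) * line_integral K.
Proof.
have iK := integrable_sawtooth L0 xi0 xiL.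
pose T (t : nat * R) (u : R) := - (t.2 * rpow (1 - xi / L) t.1) * K (u + - lambda t)
   + t.2 * t.1%:R^-1 * K u + 0 * K u.
have ET : (fun u => W u) = (fun u => \sum_(t <- terms q f) T t u).
  apply/funext => u; rewrite weighted_discrepancy // -sumrN.
  by apply: eq_bigr => t _; rewrite /T; ring.
have HT t := @line_integral_lin3 _ _ _ (- (t.2 * rpow (1 - xi / L) t.1)) (t.2 * t.1%:R^-1) 0
  (integrable_shift (- lambda t) iK) iK iK.
rewrite ET; have [iT ->] := @line_integral_sum _ _ (terms q f) T (fun t _ => (HT t).1).
split=> //; rewrite G1_eq_sum_terms // -sumrB mulr_suml; apply: eq_bigr => t _.
by rewrite (HT t).2 line_integral_shift //; ring.
Qed.

(** The addition formula for [pi * u = pi * (u - ln d / ln z) + pi * ln d / ln z] turns the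
    translations into the phases of [G]; with its sine companion this is the product
    [- (G - G1) * (C_ + i S_)] read on real and imaginary parts. *)
Lemma cos_transform_discrepancy :
  integrableR (fun u => W u * cos (pi * u)) /\
  line_integral (fun u => W u * cos (pi * u)) =
  complex.Im G * S_ - (complex.Re G - G1 q f) * C_.
Proof.
have iC := integrable_sawtooth_cos L0 xi0 xiL.
have iS := integrable_sawtooth_sin L0 xi0 xiL.
pose FC u := K u * cos (pi * u); pose FS u := K u * sin (pi * u).
pose T (t : nat * R) (u : R) :=
   - (t.2 * (rpow (1 - xi / L) t.1 * cos (pi / L * ln t.1%:R))) * FC (u + - lambda t)
   + (t.2 * (rpow (1 - xi / L) t.1 * sin (pi / L * ln t.1%:R))) * FS (u + - lambda t)
   + t.2 * t.1%:R^-1 * FC u.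
have ET : (fun u => W u * cos (pi * u)) = (fun u => \sum_(t <- terms q f) T t u).
  apply/funext => u; rewrite weighted_discrepancy // -sumrN mulr_suml.
  apply: eq_bigr => t _; rewrite /T /FC /FS.
  have -> : cos (pi * u) = cos (pi * (u - lambda t)) * cos (pi / L * ln t.1%:R)
      - sin (pi * (u - lambda t)) * sin (pi / L * ln t.1%:R).
    by rewrite -cosD; congr cos; ring.
  by ring.
have HT t := @line_integral_lin3 _ _ _
  (- (t.2 * (rpow (1 - xi / L) t.1 * cos (pi / L * ln t.1%:R))))
  (t.2 * (rpow (1 - xi / L) t.1 * sin (pi / L * ln t.1%:R)))
  (t.2 * t.1%:R^-1)
  (integrable_shift (- lambda t) iC) (integrable_shift (- lambda t) iS) iC.
rewrite ET; have [iT ->] := @line_integral_sum _ _ (terms q f) T (fun t _ => (HT t).1).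
split=> //; rewrite G1_eq_sum_terms // Re_sum Im_sum -sumrB !mulr_suml -sumrB.
apply: eq_bigr => t _.
rewrite (HT t).2 (line_integral_shift _ iC) (line_integral_shift _ iS) /cos_moment /sin_moment /=.
by ring.
Qed.

Lemma sin_transform_discrepancy :
  integrableR (fun u => W u * sin (pi * u)) /\
  line_integral (fun u => W u * sin (pi * u)) =
  - (complex.Im G * C_ + (complex.Re G - G1 q f) * S_).
Proof.
have iC := integrable_sawtooth_cos L0 xi0 xiL.
have iS := integrable_sawtooth_sin L0 xi0 xiL.
pose FC u := K u * cos (pi * u); pose FS u := K u * sin (pi * u).
pose T (t : nat * R) (u : R) :=
   - (t.2 * (rpow (1 - xi / L) t.1 * sin (pi / L * ln t.1%:R))) * FC (u + - lambda t)
   + - (t.2 * (rpow (1 - xi / L) t.1 * cos (pi / L * ln t.1%:R))) * FS (u + - lambda t)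
   + t.2 * t.1%:R^-1 * FS u.
have ET : (fun u => W u * sin (pi * u)) = (fun u => \sum_(t <- terms q f) T t u).
  apply/funext => u; rewrite weighted_discrepancy // -sumrN mulr_suml.
  apply: eq_bigr => t _; rewrite /T /FC /FS.
  have -> : pi * u = pi * (u - lambda t) + pi / L * ln t.1%:R by ring.
  by rewrite sinD; ring.
have HT t := @line_integral_lin3 _ _ _
  (- (t.2 * (rpow (1 - xi / L) t.1 * sin (pi / L * ln t.1%:R))))
  (- (t.2 * (rpow (1 - xi / L) t.1 * cos (pi / L * ln t.1%:R))))
  (t.2 * t.1%:R^-1)
  (integrable_shift (- lambda t) iC) (integrable_shift (- lambda t) iS) iS.
rewrite ET; have [iT ->] := @line_integral_sum _ _ (terms q f) T (fun t _ => (HT t).1).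
split=> //; rewrite G1_eq_sum_terms // Re_sum Im_sum -sumrB !mulr_suml -big_split -sumrN.
apply: eq_bigr => t _.
rewrite (HT t).2 (line_integral_shift _ iC) (line_integral_shift _ iS) /cos_moment /sin_moment /=.
by ring.
Qed.

Lemma aligned_unit_vector (x y : R) : exists a b : R,
  a ^+ 2 + b ^+ 2 = 1 /\ a * x + b * y = Num.sqrt (x ^+ 2 + y ^+ 2).
Proof.
set n := Num.sqrt _.
have n2 : n ^+ 2 = x ^+ 2 + y ^+ 2 by rewrite sqr_sqrtr // addr_ge0 ?sqr_ge0.
have [n0|n0] := eqVneq n 0.
  exists 1, 0; rewrite expr1n expr0n addr0 mul1r mul0r addr0 n0; split=> //.
  apply/eqP; rewrite -sqrf_eq0; apply/eqP/le_anti; rewrite sqr_ge0 andbT.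
  by move: n2; rewrite n0 expr0n /=; have := sqr_ge0 y; lra.
exists (x / n), (y / n); split.
  have -> : (x / n) ^+ 2 + (y / n) ^+ 2 = (x ^+ 2 + y ^+ 2) / n ^+ 2 by field.
  by rewrite -n2 divff // expf_neq0.
have -> : x / n * x + y / n * y = (x ^+ 2 + y ^+ 2) / n by field.
by rewrite -n2 expr2 mulfK.
Qed.

(** By Cauchy-Schwarz a cosine wave of a suitable phase recovers the modulus of the Fourier
    transform, which is the product of the moduli of [C_ + i S_] and [G - G1]. *)
Lemma resonant_direction : 0 <= C_ -> 1 <= normc G -> exists a b : R, a ^+ 2 + b ^+ 2 = 1 /\
  C_ * (normc G - 1) <=
  a * line_integral (fun u => W u * cos (pi * u)) + b * line_integral (fun u => W u * sin (pi * u)).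
Proof.
move=> C0 G1n; have [a [b [ab E]]] := aligned_unit_vector
  (line_integral (fun u => W u * cos (pi * u)))
  (line_integral (fun u => W u * sin (pi * u))).
exists a, b; split=> //; rewrite {}E.
have [_ ->] := cos_transform_discrepancy; have [_ ->] := sin_transform_discrepancy.
set g := G; set g1 := G1 q f.
have -> : (complex.Im g * S_ - (complex.Re g - g1) * C_) ^+ 2
    + (- (complex.Im g * C_ + (complex.Re g - g1) * S_)) ^+ 2 =
  ((complex.Re g - g1) ^+ 2 + complex.Im g ^+ 2) * (C_ ^+ 2 + S_ ^+ 2) by ring.
rewrite sqrtrM ?addr_ge0 ?sqr_ge0 //.
have /andP[g10 g11] : 0 <= g1 <= 1 by exact: G1_itv.
have gn : normc g - 1 <= Num.sqrt ((complex.Re g - g1) ^+ 2 + complex.Im g ^+ 2).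
  have -> : Num.sqrt ((complex.Re g - g1) ^+ 2 + complex.Im g ^+ 2) = normc (g - g1%:C%C).
    by case: (g) => x y; rewrite /normc /= subr0.
  rewrite lerBlDr -{1}(subrK g1%:C%C g); apply: le_trans (le_normcD _ _) _.
  by rewrite lerD2l normc_real ger0_norm.
have Cn : `|C_| <= Num.sqrt (C_ ^+ 2 + S_ ^+ 2).
  by rewrite -sqrtr_sqr ler_wsqrtr // lerDl sqr_ge0.
by rewrite mulrC; apply: ler_pM => //; [rewrite subr_ge0 | exact: le_trans (ler_norm _) Cn].
Qed.
End Fixed.
End Moments.

(** * Large values of both signs *)

Section Oscillation.
Context {R : realType}.
Variables (q : nat) (f : nat -> R) (z xi : R).
Hypotheses (q0 : (0 < q)%N) (adm : admissible q f) (L1 : 10 ^+ 6 <= ln z).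
Hypothesis qz : forall p : nat, prime p -> (p %| q)%N -> p%:R <= z.
Hypotheses (xipi : pi <= xi) (xiL : xi <= 2 / 3 * ln z).
Hypothesis Hbig : 20 * Hj q f 2 z xi + 76 * J q z xi + 20 <= H q f z xi.
Local Notation L := (ln z).
Local Notation Hx := (H q f z xi).
Local Notation H2 := (Hj q f 2 z xi).
Local Notation Jx := (J q z xi).
Local Notation tau := (tau q f z xi).
Local Notation X := (expR (Hx - 5 * H2 - 5 * Jx)).
Local Notation W u := (expR (xi * u) * discrepancy q f z u).
Local Notation lambda t := (ln t.1%:R / ln z).

Let L0 : 0 < L. Proof. by move: L1; lra. Qed.
Let xi2 : 2 <= xi. Proof. exact: le_trans (@pi_ge2 R) xipi. Qed.

Lemma J_ge0 y : 0 <= J q z y.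
Proof. by rewrite J_rpow // sumr_ge0 // => p _; rewrite sqr_ge0. Qed.

Lemma H2_ge0 : 0 <= H2.
Proof.
rewrite H2_rpow // big_seq sumr_ge0 // => p pq.
by have /andP[_ f1] := f_le1 adm pq; rewrite mulr_ge0 ?sqr_ge0 // mulr_ge0 ?rpow_ge0 // subr_ge0.
Qed.

Lemma H_ge20 : 20 <= Hx.
Proof. by have := H2_ge0; have := J_ge0 xi; move: Hbig; lra. Qed.

Lemma tau_sqrM : tau ^+ 2 * Hx = 5 * H2 + 19 * Jx + 5.
Proof.
have h := H_ge20; have j := J_ge0 xi; have h2 := H2_ge0.
rewrite sqr_sqrtr ?divr_ge0 //; [|by lra|by lra].
by rewrite divfK // gt_eqF //; lra.
Qed.

Lemma tau_ge0 : 0 <= tau. Proof. exact: sqrtr_ge0. Qed.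

Lemma tau_le_half : tau <= 1 / 2.
Proof.
have h := H_ge20; have e := tau_sqrM; have t0 := tau_ge0.
rewrite leNgt; apply/negP => t2.
have : 1 / 4 * Hx < tau ^+ 2 * Hx by rewrite ltr_pM2r; nra.
by rewrite e; move: Hbig; lra.
Qed.

Lemma rpow_shift (d : R) p : prime p ->
  rpow (1 - (xi + d) / L) p = rpow (1 - xi / L) p * expR (d * (ln p%:R / L)).
Proof. by move=> pp; rewrite /rpow -expRD; congr expR; ring. Qed.

(** For [d <= 1 / 2] the exponential [expR d] is at most [1 + d + d ^+ 2], and
    [5 * expR (2 * d) <= 5 * 14 / 5 = 14]. *)
Lemma H_J_shift_up (d : R) : 0 <= d -> d <= 1 / 2 ->
  H q f z (xi + d) + 5 * J q z (xi + d) <= Hx * (1 + d + d ^+ 2) + 14 * Jx.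
Proof.
move=> d0 d2; apply: lerD.
  rewrite !H_rpow mulr_suml big_seq [leRHS]big_seq; apply: ler_sum => p pq.
  have pp : prime p by move: pq; rewrite mem_primes => /andP[].
  have /andP[_ f1] := f_le1 adm pq; have /andP[r0 r1] := ratio_itv L1 qz pq.
  rewrite rpow_shift // [leLHS]mulrA.
  apply: ler_wpM2l; first by rewrite mulr_ge0 ?rpow_ge0 // subr_ge0.
  apply: (@le_trans _ _ (expR d)); first by rewrite ler_expR ler_piMr.
  by apply: expR_le_1DDsqr; lra.
rewrite !J_rpow // !mulr_sumr big_seq [leRHS]big_seq; apply: ler_sum => p pq.
have pp : prime p by move: pq; rewrite mem_primes => /andP[].
have /andP[r0 r1] := ratio_itv L1 qz pq.
rewrite rpow_shift // exprMn mulrCA [14 * _]mulrC ler_wpM2l ?sqr_ge0 //.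
rewrite -expRM_natl.
have : expR (2%:R * (d * (ln p%:R / L))) <= expR 1 by rewrite ler_expR; nra.
by have := @expR1_le R; lra.
Qed.

(** With [t = 1 - ln p / ln z], the factor [expR (- d * (1 - t))] is at most
    [1 - d + d * t + d ^+ 2 / 2], and [d * t <= d ^+ 2 / 4 + t ^+ 2] brings in the second moment
    [Hj 2] instead of the first one. *)
Lemma H_J_shift_down (d : R) : 0 <= d ->
  H q f z (xi - d) + 5 * J q z (xi - d) <= Hx * (1 - d + 3 / 4 * d ^+ 2) + H2 + 5 * Jx.
Proof.
move=> d0; apply: lerD.
  rewrite !H_rpow H2_rpow // mulr_suml -big_split big_seq [leRHS]big_seq; apply: ler_sum => p pq.
  have pp : prime p by move: pq; rewrite mem_primes => /andP[].
  have /andP[_ f1] := f_le1 adm pq; have /andP[r0 r1] := ratio_itv L1 qz pq.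
  rewrite rpow_shift // [leLHS]mulrA /= -mulrDr.
  apply: ler_wpM2l; first by rewrite mulr_ge0 ?rpow_ge0 // subr_ge0.
  set r := ln p%:R / L in r0 r1 *.
  rewrite mulNr; apply: le_trans (expRN_le_quadratic _) _; first exact: mulr_ge0.
  have : (d * r) ^+ 2 <= d ^+ 2 by rewrite exprMn ler_piMr ?sqr_ge0 // exprn_ile1.
  have : 0 <= (d / 2 - (1 - r)) ^+ 2 by exact: sqr_ge0.
  by lra.
rewrite ler_pM2l // !J_rpow // big_seq [leRHS]big_seq; apply: ler_sum => p pq.
have pp : prime p by move: pq; rewrite mem_primes => /andP[].
have /andP[r0 r1] := ratio_itv L1 qz pq.
rewrite rpow_shift // exprMn ler_piMr ?sqr_ge0 // -expRM_natl -[leRHS](@expR0 R) ler_expR.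
by rewrite mulNr mulrN oppr_le0 mulr_ge0 // mulr_ge0.
Qed.

(** The pointwise majorant of [expR (y * u) * |E u|]. *)
Definition majorant y u : R :=
  \sum_(t <- terms q f) `|t.2| * rpow (1 - y / L) t.1 * tent y (L - y) (u - lambda t).

Lemma majorant_ge0 y u : 0 <= majorant y u.
Proof. by apply: sumr_ge0 => t _; rewrite !mulr_ge0 ?rpow_ge0 ?tent_ge0. Qed.

Lemma line_integral_majorant (y : R) : 0 < y -> y < L ->
  integrableR (majorant y) /\
  line_integral (majorant y) =
  (y^-1 + (L - y)^-1) * \sum_(t <- terms q f) `|t.2| * rpow (1 - y / L) t.1.
Proof.
move=> y0 yL.
have [it itE] := @line_integral_tent R y (L - y) y0 ltac:(by rewrite subr_gt0).
have HT (t : nat * R) := line_integralZ (`|t.2| * rpow (1 - y / L) t.1)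
  (integrable_shift (- lambda t) it).
have [iM E] := @line_integral_sum _ _ (terms q f)
  (fun t u => `|t.2| * rpow (1 - y / L) t.1 * tent y (L - y) (u - lambda t)) (fun t _ => (HT t).1).
split=> //; rewrite [LHS]E mulr_sumr; apply: eq_bigr => t _.
by rewrite (HT t).2 line_integral_shift // itE mulrC.
Qed.

Let u0 := Hx * (1 - 2 * tau).
Let u1 := Hx * (1 + 2 * tau).

(** A majorant of [|W|] outside the interval from [u0] to [u1], from the majorants with the
    exponent [xi] moved by [tau] in either direction. *)
Definition tails u : R := expR (- (tau * u1)) * majorant (xi + tau) u
                        + expR (tau * u0) * majorant (xi - tau) u.

Lemma tails_ge0 u : 0 <= tails u.
Proof. by rewrite addr_ge0 // mulr_ge0 ?expR_ge0 ?majorant_ge0. Qed.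

Lemma norm_W_le_tails u : ~~ (u0 <= u <= u1) -> `|W u| <= tails u.
Proof.
have t0 := tau_ge0.
have key y : `|W u| <= expR (- (y * u)) * majorant (xi + y) u.
  have -> : W u = expR (- (y * u)) * (expR ((xi + y) * u) * discrepancy q f z u).
    by rewrite mulrA -expRD; congr (expR _ * _); ring.
  rewrite normrM ger0_norm ?expR_ge0 // ler_wpM2l ?expR_ge0 //.
  exact: norm_weighted_discrepancy_le.
rewrite negb_and -!ltNge => /orP[uu|uu].
  apply: le_trans (key (- tau)) _; rewrite mulNr opprK -[leLHS]add0r lerD //.
    by rewrite mulr_ge0 ?expR_ge0 ?majorant_ge0.
  by rewrite ler_wpM2r ?majorant_ge0 // ler_expR ler_wpM2l // ltW.
apply: le_trans (key tau) _; rewrite -[leLHS]addr0 lerD //.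
  by rewrite ler_wpM2r ?majorant_ge0 // ler_expR lerN2 ler_wpM2l // ltW.
by rewrite mulr_ge0 ?expR_ge0 ?majorant_ge0.
Qed.

(** Integrating the majorant itself, which is concentrated near the points [ln d / ln z],
    gains a factor of order [1 / xi]. Its supremum, integrated against [expR (- tau * u)],
    would give [1 / tau] instead, which is not enough when [xi] is much larger than [H]. *)
Lemma line_integral_tail y e : 0 < y -> y < L -> 10 / 31 <= 1 - y / L ->
  y^-1 + (L - y)^-1 <= 4 / xi ->
  e + (H q f z y + 5 * J q z y) <= Hx - 5 * H2 - 5 * Jx - 5 ->
  integrableR (fun u => expR e * majorant y u) /\
  line_integral (fun u => expR e * majorant y u) <= X / (20 * xi).
Proof.
move=> y0 yL yL3 y4 he.
have x0 : 0 < xi by have := xi2; lra.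
have [iM eM] := line_integral_majorant y0 yL.
have [i ->] := line_integralZ (expR e) iM; split=> //; rewrite eM.
set S := \sum_(t <- _) _.
have S0 : 0 <= S by apply: sumr_ge0 => t _; rewrite mulr_ge0 ?rpow_ge0.
have eS : expR e * S <= X / 80.
  apply: (@le_trans _ _ (X / expR 5)).
    rewrite -expRB; apply: le_trans (_ : expR (e + (H q f z y + 5 * J q z y)) <= _).
      by rewrite expRD ler_wpM2l ?expR_ge0 // sum_norm_terms_le_H.
    by rewrite ler_expR.
  by rewrite ler_wpM2l ?expR_ge0 // lef_pV2 ?posrE ?expR_gt0 // expR5_ge.
have -> : X / (20 * xi) = 4 / xi * (X / 80) by field; rewrite gt_eqF.
rewrite mulrCA; apply: ler_pM => //; last by rewrite mulr_ge0 ?expR_ge0.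
by rewrite addr_ge0 // invr_ge0 ltW // subr_gt0.
Qed.

Lemma line_integral_tails :
  integrableR tails /\ line_integral tails <= X / (10 * xi).
Proof.
have t0 := tau_ge0; have t2 := tau_le_half; have x2 := xi2; have xl := xiL.
have l1 : 1000 <= L by move: L1; lra.
have x0 : 0 < xi by lra.
have j0 := J_ge0 xi; have h0 := H2_ge0; have tH := tau_sqrM.
have inv_le (y k : R) : 0 < k -> xi / k <= y -> y^-1 <= k / xi.
  move=> k0 h; rewrite -invf_div lef_pV2 ?posrE ?divr_gt0 //.
  by apply: lt_le_trans h; rewrite divr_gt0.
have ratio y : y <= 2 / 3 * L + 1 / 2 -> 10 / 31 <= 1 - y / L.
  by move=> h; rewrite lerBrDr -lerBrDl ler_pdivrMr //; lra.
have [i1 e1] := @line_integral_tail (xi + tau) (- (tau * u1)) ltac:(lra) ltac:(lra)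
  ltac:(apply: ratio; lra)
  ltac:(have := @inv_le (xi + tau) 1 ltac:(lra) ltac:(lra);
        have := @inv_le (L - (xi + tau)) 3 ltac:(lra) ltac:(lra); lra)
  ltac:(have := H_J_shift_up t0 t2; rewrite /u1; lra).
have [i2 e2] := @line_integral_tail (xi - tau) (tau * u0) ltac:(lra) ltac:(lra)
  ltac:(apply: ratio; lra)
  ltac:(have := @inv_le (xi - tau) 2 ltac:(lra) ltac:(lra);
        have := @inv_le (L - (xi - tau)) 2 ltac:(lra) ltac:(lra); lra)
  ltac:(have := H_J_shift_down t0; rewrite /u0; lra).
have [i ->] := line_integralD i1 i2; split=> //.
have -> : X / (10 * xi) = X / (20 * xi) + X / (20 * xi) by field; rewrite gt_eqF.
exact: lerD.
Qed.

Lemma cos_moment_lower : 49 / 100 / xi <= cos_moment L xi.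
Proof.
have x2 := xi2; have xl := xiL; have x0 : 0 < xi by lra.
have l1 : 6000 <= L by move: L1; lra.
apply: le_trans (@cos_moment_ge R L xi L0 x0 ltac:(lra)).
have p0 := @pi_gt0 R.
have h1 : 1 / 2 / xi <= xi / (xi ^+ 2 + pi ^+ 2).
  have D0 : 0 < xi ^+ 2 + pi ^+ 2 by rewrite addr_gt0 ?exprn_gt0.
  rewrite ler_pdivlMr // mulrAC ler_pdivrMr //.
  have : pi ^+ 2 <= xi ^+ 2 by rewrite lerXn2r ?nnegrE ?(ltW p0) // ltW.
  by rewrite !expr2; lra.
have h2 : expR (- ((L - xi) / 4)) <= 1 / 400.
  have h := expR_ge1Dx ((L - xi) / 4).
  rewrite expRN -[leLHS]mul1r ler_pdivrMr ?expR_gt0; lra.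
have h3 : 2 / (L - xi) <= 4 / xi.
  rewrite ler_pdivrMr; last by lra.
  by rewrite mulrAC ler_pdivlMr //; lra.
have h4 : expR (- ((L - xi) / 4)) * (2 / (L - xi)) <= 1 / 400 * (4 / xi).
  apply: ler_pM => //.
  by rewrite divr_ge0 // subr_ge0; lra.
have -> : 49 / 100 / xi = 1 / 2 / xi - 1 / 400 * (4 / xi) by field; rewrite gt_eqF.
exact: lerB.
Qed.

Lemma X_ge80 : 80 <= X.
Proof.
apply: le_trans (@expR5_ge R) _; rewrite ler_expR.
by have := H2_ge0; have := J_ge0 xi; move: Hbig; lra.
Qed.

(** Suppose that [s * W] stays below [c] on the interval. The wave
    [v = s * (a * cos (pi * u) + b * sin (pi * u))] has values between [-1] and [1], so
    [s * W * (1 + v)] is at most [2 * c] on the interval and at most [2 * tails] outside. Its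
    integral is then at most [2 * X / (5 * xi)], but by [resonant_direction] it is at least
    [0.49 * (X - 1) / xi - 3 / xi], which is larger as [X >= 80]. *)
Lemma large_value (s : R) : s ^+ 2 = 1 ->
  exists u, u0 <= u <= u1 /\ X / (20 * xi * Hx) <= s * W u.
Proof.
move=> s2; apply: contrapT => nex.
set c := X / (20 * xi * Hx) in nex.
have x2 := xi2; have xl := xiL; have x0 : 0 < xi by lra.
have h20 := H_ge20; have x80 := X_ge80; have t0 := tau_ge0; have t2 := tau_le_half.
have xL : xi < L by move: L1; lra.
have small u : u0 <= u <= u1 -> s * W u <= c.
  by move=> uI; rewrite leNgt; apply/negP => h; apply: nex; exists u; split=> //; exact: ltW.
have c0 : 0 <= c by rewrite divr_ge0 ?expR_ge0 // !mulr_ge0 //; lra.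
have C49 := cos_moment_lower.
have C0 : 0 <= cos_moment L xi by apply: le_trans C49; rewrite divr_ge0 //; lra.
have GX := normc_sum_terms_ge_H adm L1 xiL.
have X1 : 1 <= X by lra.
have [a [b [ab ineq]]] := resonant_direction q0 adm L0 x0 xL C0 (le_trans X1 GX).
have [iW eW] := mean_discrepancy q0 adm L0 x0 xL.
have [iC _] := cos_transform_discrepancy q0 adm L0 x0 xL.
have [iS _] := sin_transform_discrepancy q0 adm L0 x0 xL.
have [iL eL] := line_integral_lin3 s a b iW iC iS.
have [i1 e1] := @line_integral_indic R u0 u1 ltac:(rewrite /u0 /u1; nra).
have [iT eT] := line_integral_tails.
have [iR eR] := line_integral_lin3 (2 * c) 2 0 i1 iT iT.
have pointwise u : s * W u + a * (W u * cos (pi * u)) + b * (W u * sin (pi * u)) <=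
    2 * c * (\1_(`[u0, u1]) u) + 2 * tails u + 0 * tails u.
  set w := W u; set v := s * (a * cos (pi * u) + b * sin (pi * u)).
  have -> : s * w + a * (w * cos (pi * u)) + b * (w * sin (pi * u)) = s * w * (1 + v).
    transitivity (s * w + s ^+ 2 * (a * (w * cos (pi * u)) + b * (w * sin (pi * u)))).
      by rewrite s2; ring.
    by rewrite /v; ring.
  have v1 : `|v| <= 1.
    rewrite -(@ler_pXn2r _ 2) ?nnegrE // expr1n real_normK ?num_real // /v exprMn s2 mul1r.
    have := cos2Dsin2 (pi * u); have := sqr_ge0 (a * sin (pi * u) - b * cos (pi * u)).
    move=> h1 h2.
    have <- : (a ^+ 2 + b ^+ 2) * (cos (pi * u) ^+ 2 + sin (pi * u) ^+ 2) = 1.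
      by rewrite ab h2 mulr1.
    by rewrite -subr_ge0; apply: le_trans h1 _; rewrite le_eqVlt; apply/orP; left; apply/eqP; ring.
  move: v1; rewrite ler_norml => /andP[v1 v2].
  have T0 := tails_ge0 u.
  rewrite mul0r addr0 indicE; have [uI|uI] := boolP (u0 <= u <= u1).
    rewrite mem_set ?mulr1 /=; last by rewrite in_itv.
    by have := small u uI; rewrite -/w => hw; nra.
  rewrite memNset ?mulr0 ?add0r /=; last by rewrite in_itv; exact/negP.
  have := norm_W_le_tails uI; rewrite -/w ler_norml => /andP[w1 w2].
  have sw : `|s * w| <= tails u.
    rewrite normrM (_ : `|s| = 1) ?mul1r ?ler_norml ?w1 //.
    by apply/eqP; rewrite -(@eqrXn2 _ 2) // ?normr_ge0 // real_normK ?num_real // s2 expr1n.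
  move: sw; rewrite ler_norml => /andP[sw1 sw2].
  by nra.
have := le_line_integral iL iR pointwise.
rewrite eL eR eW e1 mul0r addr0.
set dG := G1 q f - _; set K0 := line_integral (sawtooth L xi).
have /andP[k0 k1] := line_integral_sawtooth_itv L0 x0 xL.
have K3 : K0 <= 3 / xi.
  apply: le_trans k1 _; have : (L - xi)^-1 <= 2 / xi.
    by rewrite -invf_div lef_pV2 ?posrE ?divr_gt0 ?subr_gt0 //; lra.
  have -> : 3 / xi = xi^-1 + 2 / xi by field; rewrite gt_eqF.
  by rewrite lerD2l.
have dG1 : `|s * (dG * K0)| <= 3 / xi.
  rewrite normrM (_ : `|s| = 1) ?mul1r; last first.
    by apply/eqP; rewrite -(@eqrXn2 _ 2) // ?normr_ge0 // real_normK ?num_real // s2 expr1n.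
  rewrite normrM (ger0_norm k0) -[leRHS]mul1r ler_pM //.
  have /andP[g0 g1] := G1_itv q0 adm.
  have /andP[g2 g3] : 0 <= \sum_(t <- terms q f) t.2 * rpow (1 - xi / L) t.1 <= 1.
    apply: sum_terms_itv => //; rewrite subr_ge0 ler_pdivrMr //; lra.
  by rewrite /dG ler_norml; apply/andP; split; lra.
have CX : 49 / 100 / xi * (X - 1) <= cos_moment L xi *
    (normc (\sum_(t <- terms q f) t.2%:C%C * cpow (1 - xi / L) (pi / L) t.1) - 1).
  apply: ler_pM; [|by rewrite subr_ge0|exact: C49|by rewrite lerD2r].
  by rewrite divr_ge0 //; lra.
have cI : 2 * c * (u1 - u0) <= X / (5 * xi).
  have -> : 2 * c * (u1 - u0) = X / (5 * xi) * (2 * tau).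
    by rewrite /c /u0 /u1; field; rewrite !gt_eqF //; lra.
  by rewrite ler_piMr ?divr_ge0 ?expR_ge0 //; lra.
have fin : X / (5 * xi) + 2 * (X / (10 * xi)) < 49 / 100 / xi * (X - 1) - 3 / xi.
  have -> : X / (5 * xi) + 2 * (X / (10 * xi)) = (2 / 5 * X) / xi by field; rewrite gt_eqF.
  have -> : 49 / 100 / xi * (X - 1) - 3 / xi = (49 / 100 * (X - 1) - 3) / xi.
    by field; rewrite gt_eqF.
  by rewrite ltr_pM2r ?invr_gt0 //; lra.
move: dG1; rewrite ler_norml => /andP[dG1 _].
by move: ineq; lra.
Qed.
End Oscillation.

Theorem theorem3p1 (R : realType) :
  exists z0 : R, forall z : R, z0 <= z ->
  forall (q : nat) (f : nat -> R), (0 < q)%N ->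
  (forall p : nat, prime p -> (p %| q)%N -> p%:R <= z) ->
  admissible q f ->
  (forall xi : R, 1 <= xi -> xi <= 2 / 3 * ln z ->
     forall u : R, 0 <= u ->
     `|E q f z u| <= expR (H q f z xi - xi * u + 5 * J q z xi))
  /\
  (forall xi : R, pi <= xi -> xi <= 2 / 3 * ln z ->
     20 * Hj q f 2 z xi + 76 * J q z xi + 20 <= H q f z xi ->
     tau q f z xi <= 1 / 2 /\
     exists u_plus u_minus : R,
     [/\ H q f z xi * (1 - 2 * tau q f z xi) <= u_plus
           <= H q f z xi * (1 + 2 * tau q f z xi),
         H q f z xi * (1 - 2 * tau q f z xi) <= u_minus
           <= H q f z xi * (1 + 2 * tau q f z xi),
         1 / (20 * xi * H q f z xi) *
           expR (H q f z xi - xi * u_plus - 5 * Hj q f 2 z xi - 5 * J q z xi)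
         <= E q f z u_plus &
         E q f z u_minus <=
         - (1 / (20 * xi * H q f z xi)) *
           expR (H q f z xi - xi * u_minus - 5 * Hj q f 2 z xi - 5 * J q z xi)]).
Proof.
exists (expR (10 ^+ 6)) => z z0z q f q0 qz adm.
have L1 : 10 ^+ 6 <= ln z.
  by rewrite -ler_expR lnK // posrE (lt_le_trans _ z0z) // expR_gt0.
split=> [xi xi1 xiL u _|xi xipi xiL Hbig].
  by apply: discrepancy_upper_bound => //; exact: le_trans ler01 xi1.
split; first exact: tau_le_half.
have L0 : 0 < ln z by move: L1; lra.
have [u [uI hu]] := large_value q0 adm L1 qz xipi xiL Hbig (expr1n _ 2).
have sqN1 : (-1 : R) ^+ 2 = 1 by rewrite sqrrN expr1n.
have [v [vI hv]] := large_value q0 adm L1 qz xipi xiL Hbig sqN1.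
have scale w : expR (H q f z xi - xi * w - 5 * Hj q f 2 z xi - 5 * J q z xi)
    = expR (H q f z xi - 5 * Hj q f 2 z xi - 5 * J q z xi) / expR (xi * w).
  by rewrite -expRB; congr expR; ring.
exists u, v; split=> //; rewrite E_discrepancy // scale.
  rewrite mulrA mul1r ler_pdivrMr ?expR_gt0 //.
  by move: hu; rewrite mul1r mulrC [X in _ <= X]mulrC.
rewrite mulrA ler_pdivlMr ?expR_gt0 // mulNr lerNr.
by move: hv; rewrite mulN1r mul1r mulrC [X in _ <= - X]mulrC.
Qed.
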